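(* Let $\mathcal{P}=\langle\Sigma\mid\mathcal{R}\rangle$ be a semigroup presentation and $w\in\Sigma^+$ a base word. Let $\mathfrak{J}$ denote the set of left hyperplanes of the Squier complex $S(\mathcal{P},w)$. Let $\mathcal{G}(\mathcal{P},w)$ be the graph of spaces defined by: - the set of vertex-spaces is $\{S(\mathcal{P},ap_J)\,\ell_J\,S(\mathcal{P},s_Jb),\ S(\mathcal{P},aq_J)\,m_J\,S(\mathcal{P},r_Jb)\mid J=[a,u\to v,b]\in\mathfrak{J}\}$; - to each left hyperplane $J=[a,u\to v,b]\in\mathfrak{J}$ is associated the edge-space $S(\mathcal{P},a)\times S(\mathcal{P},b)$ (the corresponding edge links the vertices $S(\mathcal{P},ap_J)\,\ell_J\,S(\mathcal{P},s_Jb)$ and $S(\mathcal{P},aq_J)\,m_J\,S(\mathcal{P},r_Jb)$); - the edge-maps are the canonical maps $S(\mathcal{P},a)\times S(\mathcal{P},b)\to S(\mathcal{P},a)\,u\,S(\mathcal{P},b)$, $(\alpha,\beta)\mapsto\alpha u\beta$, and $S(\mathcal{P},a)\times S(\mathcal{P},b)\to S(\mathcal{P},a)\,v\,S(\mathcal{P},b)$, $(\alpha,\beta)\mapsto\alpha v\beta$ (whose images are contained in the two vertex-spaces respectively). Then $\mathcal{G}(\mathcal{P},w)$ defines a decomposition of $S(\mathcal{P},w)$ as a graph of spaces.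
   Context: A semigroup presentation $\mathcal{P}=\langle\Sigma\mid\mathcal{R}\rangle$ consists of an alphabet $\Sigma$ and a set $\mathcal{R}$ of relations $u=v$ with $u,v\in\Sigma^+$. Here $\Sigma^+$ is the free semigroup of non-empty words and $\Sigma^*=\Sigma^+\cup\{1\}$ also contains the empty word $1$. Convention: if $u=v\in\mathcal{R}$ then $v=u\notin\mathcal{R}$ (in particular $u=u\notin\mathcal{R}$). The Squier complex $S(\mathcal{P})$ is the cube complex whose vertices are the words over $\Sigma$; whose oriented edges are $(a,u\to v,b)$ with $a,b\in\Sigma^*$ and $u=v$ or $v=u$ in $\mathcal{R}$, going from $aub$ to $avb$ (and $(a,v\to u,b)$ is the same edge with opposite orientation); and whose $n$-cubes are similarly $(a_1,u_1\to v_1,\dots,a_n,u_n\to v_n,a_{n+1})$, spanned by the vertices $a_1w_1\cdots a_nw_na_{n+1}$ with $w_i\in\{u_i,v_i\}$. $S(\mathcal{P},w)$ is the connected component containing $w$, and $D(\mathcal{P},w)=\pi_1(S(\mathcal{P},w),w)$ is the diagram group; for the empty word, $S(\mathcal{P},1)$ is a single vertex and $D(\mathcal{P},1)=\{1\}$. $S(\mathcal{P},a)\,u\,S(\mathcal{P},b)$ denotes the image in $S(\mathcal{P})$ of the combinatorial map $S(\mathcal{P},a)\times S(\mathcal{P},b)\to S(\mathcal{P})$, $(\alpha,\beta)\mapsto\alpha u\beta$. A hyperplane is an equivalence class of edges for the equivalence relation generated by: two edges are equivalent if they are parallel sides of some square. $[a,u\to v,b]$ is the hyperplane containing the edge $(a,u\to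 v,b)$. A hyperplane $J=[a,u\to v,b]$ of $S(\mathcal{P},w)$ is left if $D(\mathcal{P},a)=\{1\}$ but $D(\mathcal{P},au)\neq\{1\}$. For such $J$, write $u=p_J\ell_Js_J$ with $p_J,s_J\in\Sigma^*$ and $\ell_J\in\Sigma$ a letter such that $D(\mathcal{P},ap_J)=\{1\}$ and $D(\mathcal{P},ap_J\ell_J)\neq\{1\}$; these are uniquely determined. Similarly write $v=q_Jm_Jr_J$ with $q_J,r_J\in\Sigma^*$, $m_J\in\Sigma$, such that $D(\mathcal{P},aq_J)=\{1\}$ and $D(\mathcal{P},aq_Jm_J)\neq\{1\}$. A graph of spaces is a graph in which each vertex $x$ is labelled by a space $S_x$, each edge $e=(e^-,e^+)$ by a space $S_e$, with two $\pi_1$-injective gluing maps $p_e^{\pm}:S_e\to S_{e^{\pm}}$. Its geometric realization is the quotient of $\bigcup_xS_x\cup\bigcup_eS_e\times[0,1]$ identifying $S_e\times\{0\}$ with its image under $p_e^-$ and $S_e\times\{1\}$ with its image under $p_e^+$. A decomposition of a space as a graph of spaces is an identification with such a geometric realization. In $\mathcal{G}(\mathcal{P},w)$, if two distinct left hyperplanes define identical vertex-spaces (as subcomplexes of $S(\mathcal{P},w)$), these give only one vertex; but distinct left hyperplanes always give distinct edges, even if their edge-spaces are identical.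
   Formalization: The formal theorem assumes D(P,w) ≠ {1}: if D(P,w) = {1} there are no left hyperplanes, so G(P,w) is empty while S(P,w) is not, and the claim fails; fundamental groups are taken as edge-path groups. *)

(* Defs.v *)
From HB Require Import structures.
From Stdlib Require Import Relation_Operators.
From mathcomp Require Import all_boot all_order all_algebra generic_quotient.
From mathcomp Require Import all_classical all_reals all_analysis.

Set Implicit Arguments.
Unset Strict Implicit.
Unset Printing Implicit Defensive.
Import Order.TTheory GRing.Theory Num.Theory numFieldNormedType.Exports.
Local Open Scope classical_set_scope.
Local Open Scope quotient_scope.

(* An n-dimensional cube is parametrized by [0,1]^n; [face c i e] is the face
   where the i-th coordinate (i < dim c, counted from 0) equals e.  The fields
   [dim], [face] live on an ambient type [cube], so that the cubes of a
   subcomplex have the same type as those of the complex. *)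
Record cube_complex := CubeComplex {
  cube : choiceType;
  dim : cube -> nat;
  face : cube -> nat -> bool -> cube;
  cubes : set cube;
  face_cubes : forall c i e, cubes c -> i < dim c -> cubes (face c i e);
  dim_face : forall c i e, i < dim c -> (dim (face c i e)).+1 = dim c;
  face_face : forall c i j d e, i < j < dim c ->
    face (face c j e) i d = face (face c i d) j.-1 e }.
Arguments dim {_} _.
Arguments face {_} _ _ _.
Arguments cubes _ : clear implicits.

Definition vertex (X : cube_complex) (x : cube X) := cubes X x /\ dim x = 0.
Definition edge (X : cube_complex) (e : cube X) := cubes X e /\ dim e = 1.
Definition square (X : cube_complex) (s : cube X) := cubes X s /\ dim s = 2.

Definition closed_under_faces (X : cube_complex) (A : set (cube X)) :=
  A `<=` cubes X /\ forall c i e, A c -> i < dim c -> A (face c i e).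

Definition subcomplex (X : cube_complex) (A : set (cube X))
    (hA : closed_under_faces A) : cube_complex :=
  @CubeComplex (cube X) dim face A hA.2 (@dim_face X) (@face_face X).

Definition combinatorial_map (X Y : cube_complex) (f : cube X -> cube Y) :=
  forall c, cubes X c ->
    [/\ cubes Y (f c), dim (f c) = dim c &
        forall i e, i < dim c -> f (face c i e) = face (f c) i e].

Lemma image_closed (X Y : cube_complex) (f : cube X -> cube Y) :
  combinatorial_map f -> closed_under_faces (f @` cubes X).
Proof.
move=> hf; split=> [_ [c cX <-]|_ i e [c cX <-]]; first by case: (hf c cX).
case: (hf c cX) => _ -> hface ilt; exists (face c i e); last exact: hface.
exact: face_cubes.
Qed.

Section Product.
Variables X Y : cube_complex.

Let pdim (c : cube X * cube Y) := (dim c.1 + dim c.2)%N.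
Let pface (c : cube X * cube Y) i e :=
  if i < dim c.1 then (face c.1 i e, c.2) else (c.1, face c.2 (i - dim c.1) e).

Let pcubes : set (cube X * cube Y) := cubes X `*` cubes Y.

Let pface_cubes c i e : pcubes c -> i < pdim c -> pcubes (pface c i e).
Proof.
case: c => c d [/= cX dY]; rewrite /pdim /pface /= => ilt.
case: ltnP => ic; split=> //=; apply: face_cubes => //.
by rewrite ltn_subLR.
Qed.

Let pdim_face c i e : i < pdim c -> (pdim (pface c i e)).+1 = pdim c.
Proof.
case: c => c d; rewrite /pdim /pface /= => ilt; case: ltnP => ic /=.
  by rewrite -addSn dim_face.
by rewrite -addnS dim_face // ltn_subLR.
Qed.

Let pface_face c i j a b : i < j < pdim c ->
  pface (pface c j b) i a = pface (pface c i a) j.-1 b.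
Proof.
case: c => c d; rewrite /pdim /pface /= => /andP[ij jlt].
case: (ltnP j (dim c)) => jc /=.
  have ic := ltn_trans ij jc.
  have Hj := dim_face b jc; have Hi := dim_face a ic.
  have -> : i < dim (face c j b) by rewrite -ltnS Hj (leq_trans _ jc).
  rewrite ic /=.
  have -> : j.-1 < dim (face c i a).
    by rewrite -ltnS Hi prednK // (leq_ltn_trans _ ij).
  by rewrite face_face // ij.
case: (ltnP i (dim c)) => ic /=.
  have Hi := dim_face a ic.
  have j0 : 0 < j by apply: leq_ltn_trans ij.
  rewrite ltnNge -ltnS Hi prednK // jc /=.
  by congr (_, face _ _ _); rewrite -Hi -[in LHS](prednK j0) subSS.
have -> : (j.-1 < dim c) = false.
  apply/negbTE; rewrite -leqNgt; apply: leq_trans ic _.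
  by rewrite -ltnS prednK // (leq_ltn_trans _ ij).
rewrite face_face; last by rewrite ltn_sub2rE // ij ltn_subLR.
by congr (_, face _ _ _); rewrite -!subn1 -!subnDA addnC.
Qed.

Definition product_complex : cube_complex :=
  CubeComplex pface_cubes pdim_face pface_face.

End Product.

Section Paths.
Variable X : cube_complex.

(* [(e, false)] is the edge e oriented from its 0-face to its 1-face,
   and [(e, true)] is the opposite orientation. *)
Definition oriented_edge := (cube X * bool)%type.
Definition origin (o : oriented_edge) := face o.1 0 o.2.
Definition terminus (o : oriented_edge) := face o.1 0 (~~ o.2).
Definition reverse (o : oriented_edge) : oriented_edge := (o.1, ~~ o.2).

Fixpoint edge_path (x : cube X) (p : seq oriented_edge) (y : cube X) : Prop :=
  if p is o :: p' then
    [/\ edge o.1, origin o = x & edge_path (terminus o) p' y]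
  else x = y.

(* The fundamental group is described by edge paths: homotopy is generated by
   the insertion or deletion of backtracks and by pushing a path across a
   square. *)
Inductive elementary_homotopy : seq oriented_edge -> seq oriented_edge -> Prop :=
| homotopy_backtrack p q o : edge o.1 ->
    elementary_homotopy (p ++ [:: o; reverse o] ++ q) (p ++ q)
| homotopy_square p q s : square s ->
    elementary_homotopy
      (p ++ [:: (face s 1 false, false); (face s 0 true, false)] ++ q)
      (p ++ [:: (face s 0 false, false); (face s 1 true, false)] ++ q).

Definition homotopic (x y : cube X) :=
  clos_refl_sym_trans (seq oriented_edge) (fun p q =>
    [/\ edge_path x p y, edge_path x q y & elementary_homotopy p q]).

Definition trivial_pi1 (x : cube X) :=
  forall p, edge_path x p x -> homotopic x x p [::].

Definition connected_to (x y : cube X) := exists p, edge_path x p y.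

Inductive iterated_face (c : cube X) : cube X -> Prop :=
| iterated_face_refl : iterated_face c c
| iterated_face_step d i e : iterated_face c d -> i < dim d ->
    iterated_face c (face d i e).

Definition component_cubes (x : cube X) : set (cube X) :=
  [set c | cubes X c /\
    forall y, iterated_face c y -> dim y = 0 -> connected_to x y].

Lemma iterated_face_trans c i e y : i < dim c ->
  iterated_face (face c i e) y -> iterated_face c y.
Proof.
move=> ilt; elim=> [|d j a _ ih jlt].
  exact: iterated_face_step (iterated_face_refl c) ilt.
exact: iterated_face_step ih jlt.
Qed.

Lemma component_closed x : closed_under_faces (component_cubes x).
Proof.
split=> [c []//|c i e [cX h] ilt]; split; first exact: face_cubes.
by move=> y /(iterated_face_trans ilt); exact: h.
Qed.

Definition component (x : cube X) : cube_complex :=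
  subcomplex (component_closed x).

End Paths.
Arguments edge_path : clear implicits.
Arguments homotopic : clear implicits.
Arguments trivial_pi1 : clear implicits.
Arguments connected_to : clear implicits.
Arguments component : clear implicits.

Lemma edge_path_cat (X : cube_complex) x y z p q :
  edge_path X x p y -> edge_path X y q z -> edge_path X x (p ++ q) z.
Proof. by elim: p x => [|o p ih] x /= => [->//|[? ? /ih h] /h]. Qed.

Lemma edge_path_rev (X : cube_complex) x y p :
  edge_path X x p y -> edge_path X y (rev (map (@reverse X) p)) x.
Proof.
elim: p x => [|o p ih] x /=; first by move->.
case=> eo <- /ih h; rewrite rev_cons -cats1.
by apply: edge_path_cat h _; split=> //=; rewrite /terminus /= negbK.
Qed.

Lemma homotopic_cat (X : cube_complex) x y z t p q p' q' :
  edge_path X x p' y -> edge_path X z q' t ->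
  homotopic X y z p q -> homotopic X x t (p' ++ p ++ q') (p' ++ q ++ q').
Proof.
move=> hp hq; elim=> [a b [ha hb ab]|a|a b _|a b c _ h1 _ h2].
- apply: rst_step; split.
  + exact: edge_path_cat hp (edge_path_cat ha hq).
  + exact: edge_path_cat hp (edge_path_cat hb hq).
  + case: ab => [r s o eo|r s o so].
      by rewrite -!catA !(catA p' r); exact: homotopy_backtrack.
    by rewrite -!catA !(catA p' r); exact: homotopy_square.
- exact: rst_refl.
- exact: rst_sym.
- exact: rst_trans h1 h2.
Qed.

Lemma homotopic_cancel (X : cube_complex) x y p :
  edge_path X x p y -> homotopic X x x (p ++ rev (map (@reverse X) p)) [::].
Proof.
elim: p x => [|o p ih] x /=; first by move=> _; exact: rst_refl.
case=> eo ox hp; rewrite rev_cons -cats1 catA.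
have h0 : edge_path X x [:: o] (terminus o) by [].
have h1 : edge_path X (terminus o) [:: reverse o] x.
  by split=> //=; rewrite /terminus /= negbK.
apply: rst_trans (homotopic_cat h0 h1 (ih _ hp)) _ => /=.
apply: rst_step; split=> //.
exact: (@homotopy_backtrack X [::] [::] o eo).
Qed.

Lemma trivial_pi1_move (X : cube_complex) x y p :
  edge_path X x p y -> trivial_pi1 X x -> trivial_pi1 X y.
Proof.
move=> hp Dx q hq; have hp' := edge_path_rev hp.
set p' := rev _ in hp'.
have /= hpp : homotopic X y y (p' ++ p) [::].
  have := homotopic_cancel hp'; rewrite {2}/p' map_rev revK -map_comp.
  by rewrite (eq_map (g := id)) ?map_id // => -[e b]; rewrite /reverse /= negbK.
have h1 := Dx _ (edge_path_cat hp (edge_path_cat hq hp')).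
have h2 := homotopic_cat hp' hp h1; rewrite cat0s in h2.
have h3 := rst_trans _ _ _ _ _ h2 hpp.
have hnil : edge_path X y [::] y by [].
have h4 := homotopic_cat hnil (edge_path_cat hq (edge_path_cat hp' hp)) hpp.
have h5 := homotopic_cat hq hnil hpp.
rewrite !cats0 /= in h4 h5.
apply: rst_trans h3; apply: rst_sym; rewrite -!catA in h4 *.
by rewrite !catA in h4 h5 *; apply: rst_trans h4 h5.
Qed.

Lemma connected_cat (X : cube_complex) x y z :
  connected_to X x y -> connected_to X y z -> connected_to X x z.
Proof. by move=> [p hp] [q hq]; exists (p ++ q); exact: edge_path_cat hp hq. Qed.

Lemma connected_sym (X : cube_complex) x y :
  connected_to X x y -> connected_to X y x.
Proof. by move=> [p hp]; exists (rev (map (@reverse X) p)); exact: edge_path_rev. Qed.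

Lemma component_cubes_eq (X : cube_complex) (x y : cube X) :
  connected_to X x y -> component_cubes x = component_cubes y.
Proof.
move=> xy; rewrite predeqE => c; split=> -[cX h]; split=> // z zc z0.
  exact: connected_cat (connected_sym xy) (h z zc z0).
exact: connected_cat xy (h z zc z0).
Qed.

Lemma trivial_pi1_component (X : cube_complex) (x y z : cube X) :
  component_cubes x = component_cubes y ->
  trivial_pi1 (component X x) z -> trivial_pi1 (component X y) z.
Proof.
rewrite /component.
move: (component_closed x) (component_closed y).
move: (component_cubes x) (component_cubes y) => A B hA hB E; subst B.
by rewrite (Prop_irrelevance hA hB).
Qed.

Definition map_path (X Y : cube_complex) (f : cube X -> cube Y)
    (p : seq (oriented_edge X)) : seq (oriented_edge Y) :=
  [seq (f o.1, o.2) | o <- p].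

(* Injectivity of pi_1(X, x) -> pi_1(Y, f x) for every base vertex x. *)
Definition pi1_injective (X Y : cube_complex) (f : cube X -> cube Y) :=
  forall x, vertex x -> forall p q, edge_path X x p x -> edge_path X x q x ->
    homotopic Y (f x) (f x) (map_path f p) (map_path f q) ->
    homotopic X x x p q.

Definition parallel (X : cube_complex) (e f : cube X) :=
  exists s i, [/\ square s, i < 2, e = face s i false & f = face s i true].

Definition hyperplane (X : cube_complex) (e : cube X) : set (cube X) :=
  [set f | clos_refl_sym_trans (cube X) (@parallel X) e f].

Section QuotientSpace.
Variables (T : topologicalType) (r : T -> T -> Prop).

Definition generated_equiv (x y : T) : bool :=
  `[< clos_refl_sym_trans T r x y >].

Lemma generated_equiv_class : equiv_class_of generated_equiv.
Proof.
split=> [x|x y|y x z].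
- exact/asboolP/rst_refl.
- by apply/asboolP/asboolP; exact: rst_sym.
- by move=> /asboolP xy /asboolP yz; apply/asboolP/(rst_trans _ _ _ _ _ xy yz).
Qed.

Canonical generated_equivRel := EquivRelPack generated_equiv_class.

Definition quotient_space : topologicalType :=
  quotient_topology {eq_quot generated_equivRel}.

Definition quotient_class (x : T) : quotient_space := \pi_quotient_space x.

End QuotientSpace.

Section Realization.
Variable R : realType.
Local Open Scope ring_scope.

Definition unit_cube n : set 'rV[R]_n := [set t | forall i, 0 <= t 0 i <= 1].
Definition unit_segment : set R := [set t | 0 <= t <= 1].

Definition cube_points (X : cube_complex) : topologicalType :=
  {c : cubes X & @unit_cube (dim (\val c))}.

Definition coordinate (X : cube_complex) (p : cube_points X)
    (i : 'I_(dim (\val (projT1 p)))) : R :=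
  (\val (projT2 p) : 'rV[R]_(dim (\val (projT1 p)))) 0 i.

(* The point p of the face [face c i e] is identified with the point q of c
   obtained by inserting the i-th coordinate e. *)
Definition face_identification (X : cube_complex) (p q : cube_points X) :=
  let c := \val (projT1 q) in
  exists (i : 'I_(dim c)) (e : bool),
    [/\ \val (projT1 p) = face c i e, coordinate i = e%:R &
        forall (j : 'I_(dim (\val (projT1 p)))) (k : 'I_(dim c)),
          k = bump i j :> nat -> coordinate j = coordinate k].

Definition realization (X : cube_complex) : topologicalType :=
  quotient_space (@face_identification X).

(* The graph of the map between realizations induced by a combinatorial map
   f, i.e. [(c, t) |-> (f c, t)]. *)
Definition realizes (X Y : cube_complex) (f : cube X -> cube Y)
    (x : realization X) (y : realization Y) :=
  exists (p : cube_points X) (q : cube_points Y),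
    [/\ x = quotient_class _ p, y = quotient_class _ q,
        \val (projT1 q) = f (\val (projT1 p)) &
        forall (i : 'I_(dim (\val (projT1 p))))
               (j : 'I_(dim (\val (projT1 q)))),
          i = j :> nat -> coordinate i = coordinate j].

End Realization.
Arguments unit_cube : clear implicits.
Arguments unit_segment : clear implicits.

(* [ends e false], [ends e true] are e^-, e^+, and likewise for [glue]. *)
Record space_graph := SpaceGraph {
  graph_vertex : choiceType;
  graph_edge : choiceType;
  vertex_space : graph_vertex -> cube_complex;
  edge_space : graph_edge -> cube_complex;
  ends : graph_edge -> bool -> graph_vertex;
  glue : forall e b, cube (edge_space e) -> cube (vertex_space (ends e b)) }.

Definition is_graph_of_spaces (G : space_graph) :=
  forall e b, combinatorial_map (@glue G e b) /\ pi1_injective (@glue G e b).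

Section GraphRealization.
Variables (R : realType) (G : space_graph).
Local Open Scope ring_scope.

Definition graph_piece (i : graph_vertex G + graph_edge G) : topologicalType :=
  match i with
  | inl x => realization R (vertex_space x)
  | inr e => (realization R (edge_space e) * unit_segment R)%type
  end.

Definition graph_points : topologicalType := {i & graph_piece i}.

Definition vertex_point (x : graph_vertex G)
    (s : realization R (vertex_space x)) : graph_points :=
  existT graph_piece (inl x) s.
Definition edge_point (e : graph_edge G)
    (s : realization R (edge_space e)) (t : unit_segment R) : graph_points :=
  existT graph_piece (inr e) (s, t).

Inductive graph_identification : graph_points -> graph_points -> Prop :=
| GraphIdentification e (b : bool) s s' (t : unit_segment R) :
    \val t = b%:R -> realizes (@glue G e b) s s' ->
    graph_identification (edge_point s t) (vertex_point s').

Definition graph_realization : topologicalType :=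
  quotient_space graph_identification.

(* An identification of (the realization of) X with the geometric realization
   of G, where each vertex-space sits in X through the map [incl]. *)
Definition decomposition (X : cube_complex)
    (incl : forall x : graph_vertex G, cube (vertex_space x) -> cube X) :=
  exists (h : graph_realization -> realization R X)
         (g : realization R X -> graph_realization),
    [/\ cancel h g, cancel g h, continuous h, continuous g &
        forall x s, realizes (incl x) s
          (h (quotient_class graph_identification (vertex_point (x := x) s)))].

End GraphRealization.

Section Squier.
Variable Sigma : choiceType.
Local Notation word := (seq Sigma).

Record presentation := Presentation {
  relations : set (word * word);
  relations_neq1 : forall u v, relations (u, v) -> u <> [::] /\ v <> [::];
  relations_asym : forall u v, relations (u, v) -> ~ relations (v, u) }.

Variable P : presentation.

(* The cube (a_1, u_1 -> v_1, ..., a_n, u_n -> v_n, a_(n+1)) is encoded as the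
   word a_1 [u_1, v_1] ... a_n [u_n, v_n] a_(n+1) over the letters of Sigma and
   additional symbols [u, v].  As [relations] is asymmetric, each cube has
   exactly one writing in which all pairs (u_i, v_i) belong to [relations];
   only this one is used. *)
Definition squier_cube : choiceType := seq (Sigma + word * word).

Definition vertex_cube (a : word) : squier_cube := map inl a.
Definition edge_cube (a : word) (r : word * word) (b : word) : squier_cube :=
  vertex_cube a ++ inr r :: vertex_cube b.

Fixpoint squier_dim (c : squier_cube) : nat :=
  match c with
  | [::] => 0
  | inl _ :: c' => squier_dim c'
  | inr _ :: c' => (squier_dim c').+1
  end.

Fixpoint squier_face (c : squier_cube) (i : nat) (e : bool) : squier_cube :=
  match c with
  | [::] => [::]
  | inl x :: c' => inl x :: squier_face c' i e
  | inr r :: c' =>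
      if i is i'.+1 then inr r :: squier_face c' i' e
      else vertex_cube (if e then r.2 else r.1) ++ c'
  end.

Definition squier_cubes : set squier_cube :=
  [set c | forall r, inr r \in c -> relations P r].

Lemma squier_dim_cat (c d : squier_cube) :
  squier_dim (c ++ d) = (squier_dim c + squier_dim d)%N.
Proof. by elim: c => [|[x|r] c ih] //=; rewrite ih. Qed.

Lemma squier_dim_vertex a : squier_dim (vertex_cube a) = 0.
Proof. by elim: a. Qed.

Lemma squier_face_cat (c d : squier_cube) i e :
  squier_face (c ++ d) i e =
  if i < squier_dim c then squier_face c i e ++ d
  else c ++ squier_face d (i - squier_dim c) e.
Proof.
elim: c i => [|[x|r] c ih] i /=; first by rewrite subn0.
  by rewrite ih; case: ifP.
case: i => [|i] /=; first by rewrite catA.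
by rewrite ih ltnS subSS; case: ifP.
Qed.

Lemma squier_cubes_cat c d :
  squier_cubes (c ++ d) <-> squier_cubes c /\ squier_cubes d.
Proof.
split=> [h|[h1 h2] r].
  by split=> r rc; apply: h; rewrite mem_cat rc ?orbT.
by rewrite mem_cat => /orP[]; [exact: h1|exact: h2].
Qed.

Lemma squier_cubes_vertex a : squier_cubes (vertex_cube a).
Proof. by move=> r /mapP[]. Qed.

Lemma squier_face_cubes c i e :
  squier_cubes c -> i < squier_dim c -> squier_cubes (squier_face c i e).
Proof.
have tl x c' : squier_cubes (x :: c') -> squier_cubes [:: x] /\ squier_cubes c'.
  by rewrite -cat1s => /squier_cubes_cat.
elim: c i => [|[x|r] c ih] i //= /tl[h1 h2].
  by move=> ilt; rewrite -cat1s; apply/squier_cubes_cat; split=> //; exact: ih.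
case: i => [_|i]; first by apply/squier_cubes_cat; split=> //; exact: squier_cubes_vertex.
rewrite ltnS => ilt.
by rewrite -cat1s; apply/squier_cubes_cat; split=> //; exact: ih.
Qed.

Lemma squier_dim_face c i e :
  i < squier_dim c -> (squier_dim (squier_face c i e)).+1 = squier_dim c.
Proof.
elim: c i => [|[x|r] c ih] i //=; first exact: ih.
case: i => [_|i]; first by rewrite squier_dim_cat squier_dim_vertex.
by rewrite ltnS /= => /ih ->.
Qed.

Lemma squier_face_face c i j d e : i < j < squier_dim c ->
  squier_face (squier_face c j e) i d = squier_face (squier_face c i d) j.-1 e.
Proof.
elim: c i j => [|[x|r] c ih] i j /=; first by rewrite andbF.
  by move=> /ih ->.
case: j => [|j]; first by [].
case: i => [|i] /=.
  by rewrite squier_face_cat squier_dim_vertex ltn0 subn0.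
rewrite !ltnS => hij; rewrite ih //.
by case: j hij => [|j] //; rewrite ltn0.
Qed.

Definition squier : cube_complex :=
  CubeComplex squier_face_cubes squier_dim_face squier_face_face.

(* S(P, a) *)
Definition squier_component (a : word) : cube_complex :=
  component squier (vertex_cube a).

(* D(P, a) = {1} *)
Definition trivial_diagram_group (a : word) : Prop :=
  trivial_pi1 (squier_component a) (vertex_cube a).

Definition squier_product (a b : word) : cube_complex :=
  product_complex (squier_component a) (squier_component b).

(* (alpha, beta) |-> alpha u beta.  The coordinates of a cube of a product are
   those of its first factor followed by those of its second factor, so this
   map preserves coordinates. *)
Definition insert_word (a u b : word) (c : cube (squier_product a b)) :
    squier_cube :=
  c.1 ++ vertex_cube u ++ c.2.

Lemma insert_word_map a u b :
  @combinatorial_map (squier_product a b) squier (@insert_word a u b).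
Proof.
case=> c d [/= [cS _] [dS _]]; rewrite /insert_word /=; split.
- apply/squier_cubes_cat; split=> //; apply/squier_cubes_cat; split=> //.
  exact: squier_cubes_vertex.
- by rewrite !squier_dim_cat squier_dim_vertex.
- move=> i e ilt; rewrite !squier_face_cat squier_dim_vertex ltn0 subn0.
  by case: ifP.
Qed.

(* The set of cubes of S(P,a) u S(P,b). *)
Definition joined_cubes (a u b : word) : set squier_cube :=
  @insert_word a u b @` cubes (squier_product a b).

Lemma joined_cubes_closed a u b : @closed_under_faces squier (joined_cubes a u b).
Proof. exact: image_closed (@insert_word_map a u b). Qed.

Variable w : word.

Definition left_representative (J : set squier_cube)
    (x : word * (word * word) * word) : Prop :=
  let: (a, (u, v), b) := x in
  [/\ @edge (squier_component w) (edge_cube a (u, v) b),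
      J = @hyperplane (squier_component w) (edge_cube a (u, v) b),
      trivial_diagram_group a & ~ trivial_diagram_group (a ++ u)].

Definition left_hyperplanes : set (set squier_cube) :=
  [set J | exists x, left_representative J x].

(* [splitting a u (p, l, s)] says that u = p l s with D(P, a p) trivial and
   D(P, a p l) nontrivial. *)
Definition splitting (a u : word) (x : word * Sigma * word) : Prop :=
  let: (p, l, s) := x in
  [/\ u = p ++ l :: s, trivial_diagram_group (a ++ p) &
      ~ trivial_diagram_group (a ++ rcons p l)].

Lemma splitting_exists a u : trivial_diagram_group a ->
  ~ trivial_diagram_group (a ++ u) -> exists x, splitting a u x.
Proof.
elim: u a => [|l u ih] a Da Dau; first by case: Dau; rewrite cats0.
have [Dal|Dal] := pselect (trivial_diagram_group (rcons a l)).
  have [|[[p m] s] [-> D1 D2]] := ih _ Dal; first by rewrite cat_rcons.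
  by exists (l :: p, m, s); split; rewrite // -cat_rcons.
by exists ([::], l, u); split; rewrite ?cats0 // cats1.
Qed.

Lemma iterated_face_edge a r c : iterated_face (X := squier) (edge_cube a r [::]) c ->
  squier_dim c = 0 ->
  c = vertex_cube (a ++ r.1) \/ c = vertex_cube (a ++ r.2).
Proof.
have h0 e : squier_face (edge_cube a r [::]) 0 e =
            vertex_cube (a ++ if e then r.2 else r.1).
  rewrite /edge_cube squier_face_cat squier_dim_vertex /=.
  by rewrite cats0 /vertex_cube map_cat.
have hd : squier_dim (edge_cube a r [::]) = 1.
  by rewrite /edge_cube squier_dim_cat squier_dim_vertex.
suff h : iterated_face (X := squier) (edge_cube a r [::]) c ->
    [\/ c = edge_cube a r [::], c = vertex_cube (a ++ r.1) |
        c = vertex_cube (a ++ r.2)].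
  by move=> /h[->|->|->] //; [rewrite hd|left|right].
elim=> [|d i e _ ih ilt]; first exact: Or31.
case: ih ilt => -> /=; rewrite ?squier_dim_vertex ?hd //.
by case: i => // _; rewrite h0; case: e; [exact: Or33|exact: Or32].
Qed.

Lemma trivial_diagram_group_relation a u v : relations P (u, v) ->
  trivial_diagram_group (a ++ v) -> trivial_diagram_group (a ++ u).
Proof.
move=> Ruv Dv.
pose e : squier_cube := edge_cube a (u, v) [::].
have eS : squier_cubes e.
  apply/squier_cubes_cat; split; first exact: squier_cubes_vertex.
  by move=> r; rewrite inE => /eqP[->].
have ed : squier_dim e = 1.
  by rewrite /e /edge_cube squier_dim_cat squier_dim_vertex.
have e0 b : squier_face e 0 b = vertex_cube (a ++ if b then v else u).
  rewrite /e /edge_cube squier_face_cat squier_dim_vertex /=.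
  by rewrite cats0 /vertex_cube map_cat.
have uv : connected_to squier (vertex_cube (a ++ u)) (vertex_cube (a ++ v)).
  by exists [:: (e, false)]; split=> //=; rewrite /origin /terminus /= e0.
have E := component_cubes_eq uv.
apply: (trivial_pi1_component (esym E)).
apply: (@trivial_pi1_move (squier_component (a ++ v)) _ _ [:: (e, true)] _ Dv).
split=> //=; rewrite /origin /terminus /= ?e0 //; split=> //; split=> //.
move=> y /iterated_face_edge h /h[]->; last by exists [::].
exact: connected_sym.
Qed.

Lemma left_representative_relation J a r b :
  left_representative J (a, r, b) -> relations P r.
Proof.
case: r => u v [[[eP _] _] _ _ _].
by apply: eP; rewrite mem_cat inE eqxx orbT.
Qed.

Lemma side_splitting_exists J a r b (side : bool) :
  left_representative J (a, r, b) ->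
  exists x, splitting a (if side then r.2 else r.1) x.
Proof.
move=> h; have Rr := left_representative_relation h.
case: r h Rr => u v [_ _ Da Dau] Ruv.
apply: splitting_exists => //; case: side => //= Dav.
exact: Dau (trivial_diagram_group_relation Ruv Dav).
Qed.

(* The definitions below fix one representative (a, (u, v), b) of
   J = [a, u -> v, b]; the edges of J are the (a', (u, v), b') with a', b' in the
   components of a and b, so that nothing depends on it.  The splitting
   is p_J, l_J, s_J on the side [false] of u, and q_J, m_J, r_J on the side [true]
   of v. *)
Definition representative (J : left_hyperplanes) : word * (word * word) * word :=
  projT1 (cid (set_valP J)).

Definition prefix_of (J : left_hyperplanes) : word := (representative J).1.1.
Definition side_word (J : left_hyperplanes) (side : bool) : word :=
  let r := (representative J).1.2 in if side then r.2 else r.1.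
Definition suffix_of (J : left_hyperplanes) : word := (representative J).2.

Lemma representativeP (J : left_hyperplanes) :
  left_representative (\val J) (representative J).
Proof. exact: projT2 (cid (set_valP J)). Qed.

Lemma side_splitting (J : left_hyperplanes) (side : bool) :
  exists x, splitting (prefix_of J) (side_word J side) x.
Proof.
have := representativeP J; rewrite /prefix_of /side_word.
by case: (representative J) => [[a r] b] /side_splitting_exists.
Qed.

Definition letter_splitting (J : left_hyperplanes) (side : bool) :
  word * Sigma * word := projT1 (cid (side_splitting J side)).

(* S(P, a p_J) l_J S(P, s_J b), resp. S(P, a q_J) m_J S(P, r_J b). *)
Definition side_cubes (J : left_hyperplanes) (side : bool) : set squier_cube :=
  let: (p, l, s) := letter_splitting J side in
  joined_cubes (prefix_of J ++ p) [:: l] (s ++ suffix_of J).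

Definition left_vertices : set (set squier_cube) :=
  [set A | exists J side, A = side_cubes J side].

Lemma left_vertices_closed (A : left_vertices) :
  @closed_under_faces squier (\val A).
Proof.
have [J [side E]] : exists J side, \val A = side_cubes J side := set_valP A.
by rewrite E /side_cubes; case: letter_splitting => -[p l] s; exact: joined_cubes_closed.
Qed.

Lemma side_cubes_vertex (J : left_hyperplanes) (side : bool) :
  side_cubes J side \in left_vertices.
Proof. by rewrite inE; exists J, side. Qed.

(* G(P, w).  Vertices are sets of cubes, so equal vertex-spaces give a single
   vertex, while edges are the left hyperplanes themselves. *)
Definition left_graph : space_graph :=
  @SpaceGraph left_vertices left_hyperplanes
    (fun A => subcomplex (left_vertices_closed A))
    (fun J => squier_product (prefix_of J) (suffix_of J))
    (fun J side => exist _ (side_cubes J side) (side_cubes_vertex J side))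
    (fun J side => @insert_word (prefix_of J) (side_word J side) (suffix_of J)).

Definition left_inclusion (A : graph_vertex left_graph)
  (c : cube (vertex_space A)) : cube (squier_component w) := c.

End Squier.

(* Main.v *)
(* A word x with D(P, x) <> 1 is uniquely of the form y l z with D(P, y) = 1 and
   D(P, y l) <> 1, because D(P, y) = 1 passes to prefixes.  Scanning a cube of
   S(P, w) in the same way, the first symbol at which the diagram group of the
   prefix becomes nontrivial is either a letter, and then the cube lies in exactly
   one vertex-space, or a pair [u, v], and then the cube is the product of a cube
   of exactly one edge-space with a segment.  This bijection on cubes respects
   faces, so it induces a homeomorphism between the realizations.

   The monotonicity of D(P, -) = 1 and the injectivity of the gluing maps on
   fundamental groups both follow from the injectivity of the translations
   x |-> a x b on homotopy classes of paths.  A path is recorded by the positions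
   and words of its successive rewriting steps; moving steps to the left through
   independent ones and cancelling inverse pairs gives a normal form that
   characterizes homotopy and commutes with translations. *)
Require Import Defs.
From Stdlib Require Import Relation_Operators.
From mathcomp Require Import all_boot all_order all_algebra generic_quotient.
From mathcomp Require Import all_classical all_reals all_analysis.
From mathcomp Require Import zify.

Set Implicit Arguments.
Unset Strict Implicit.
Unset Printing Implicit Defensive.
Import Order.TTheory GRing.Theory Num.Theory numFieldNormedType.Exports.
(* [dim] is also a constant of the vector space library. *)
Import Defs.
Local Open Scope classical_set_scope.
Local Open Scope quotient_scope.

(** * Quotients of topological spaces *)

(** Nontriviality of D(P, w) makes the scan of every cube stop: were it trivial, no prefix would be
    nontrivial, there would be no left hyperplane, and the graph would be empty.

    Vertex-spaces are indexed by hyperplanes, so a cube that splits at a letter l is not covered by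
    definition: some left hyperplane must have the space S(P, a) l S(P, b) on one of its sides. It
    comes from a nontrivial loop at al, which has to rewrite the last letter, since D(P, a) = 1.

    The topological obstacle is that an edge contributes the product of a quotient with a segment,
    whereas the cubes of the complex form a quotient of products; compactness of small closed
    intervals makes the two topologies agree.

    For a gluing map, D(P, a) = 1 pushes each loop of the edge-space into a slice of S(P, b), where
    gluing is a left translation. Uniqueness of normal forms is obtained in the manner of van der
    Waerden: steps act on reduced sequences, and the action respects both generators of homotopy, so
    no confluence argument is needed. *)

Section QuotientLift.
Variables (T : topologicalType) (r : T -> T -> Prop).

Lemma quotient_classP x y :
  quotient_class r x = quotient_class r y <-> clos_refl_sym_trans T r x y.
Proof.
split=> [h|h]; last by apply/eqmodP/asboolP.
by apply/asboolP; rewrite -/(generated_equiv r x y); apply/eqmodP.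
Qed.

Lemma quotient_class_repr (x : quotient_space r) : quotient_class r (repr x) = x.
Proof. exact: reprK. Qed.

Lemma quotient_class_continuous : continuous (quotient_class r).
Proof. exact: pi_continuous. Qed.

Variables (Z : topologicalType) (f : T -> Z).
Hypothesis f_compat : forall x y, r x y -> f x = f y.

Definition quotient_lift (x : quotient_space r) : Z := f (repr x).

Lemma quotient_liftE x : quotient_lift (quotient_class r x) = f x.
Proof.
have h y z : clos_refl_sym_trans T r y z -> f y = f z.
  by elim=> [? ? /f_compat|//|? ? _ ->|? ? ? _ -> _ ->].
by apply: h; apply/quotient_classP; rewrite quotient_class_repr.
Qed.

Lemma quotient_lift_continuous : continuous f -> continuous quotient_lift.
Proof.
move=> cf; apply/quotient_continuous.
by rewrite (_ : _ \o _ = f) //; apply/funext => x; exact: quotient_liftE.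
Qed.

End QuotientLift.

(* Whitehead's lemma: the product of a quotient map with the identity of a
   locally compact space is again a quotient map. *)
Lemma quotient_product_continuous (T K Z : topologicalType) (r : T -> T -> Prop)
    (f : quotient_space r * K -> Z) :
  (forall (s : K) N, nbhs s N -> exists C, [/\ nbhs s C, C `<=` N & compact C]) ->
  continuous (fun x : T * K => f (quotient_class r x.1, x.2)) ->
  continuous f.
Proof.
move=> lcK cf [x s] U /=; rewrite nbhsE => -[W [oW Wxs] WU].
have [p xE] : exists p, x = quotient_class r p.
  by exists (repr x); rewrite quotient_class_repr.
have cfW y t : W (f (quotient_class r y, t)) ->
    nbhs (y, t) (fun z => W (f (quotient_class r z.1, z.2))).
  by move=> Wyt; apply: (cf (y, t)); exact: open_nbhs_nbhs.
(* [C] is a compact neighbourhood of [s] on which [f (x, _)] stays in [W]. *)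
have [|C [sC CW cC]] := lcK s (fun t => W (f (x, t))).
  have [[A B] /= [pA sB] AB] : nbhs (p, s) (fun z => W (f (quotient_class r z.1, z.2))).
    by apply: cfW; rewrite -xE.
  apply: filterS sB => t Bt; rewrite /= xE; apply: (AB (p, t)); split => //=.
  exact: nbhs_singleton.
(* Openness of [V] in the quotient is openness of its preimage in [T], which the tube lemma along
   the compact [C] provides. *)
pose V : set (quotient_space r) := fun y => C `<=` (fun t => W (f (y, t))).
have oV : open V.
  rewrite /open /= /quotient_open openE => y Vy.
  have /compact_near_coveringP/(_ _ (nbhs y)
    (fun z t => W (f (quotient_class r z, t)))) := cC.
  move=> /(_ _) h; apply: h => t Ct.
  have [[A B] /= [yA tB] AB] := cfW _ _ (Vy _ Ct).
  by exists (B, A) => //= -[b a] [/= Bb Aa]; exact: (AB (a, b)).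
have Vx : V x by move=> t /CW.
have xV : nbhs x V by apply: open_nbhs_nbhs; split.
exists (V, C) => /=; first by split.
by move=> [y t] [/= Vy Ct]; apply: WU; exact: Vy.
Qed.

(** * The unit segment: retraction from the line and local compactness *)

Section UnitSegment.
Variable R : realType.
Local Open Scope ring_scope.

Lemma set_type_continuous (X Z : topologicalType) (A : set X) (f : Z -> A) :
  continuous (fun z => \val (f z)) -> continuous f.
Proof. by move=> cf; apply: continuous_comp_initial. Qed.

Lemma set_val_continuous (X : topologicalType) (A : set X) :
  continuous (fun x : A => \val x).
Proof. exact: initial_continuous. Qed.

Lemma clamp_subproof (x : R) : Num.max 0 (Num.min x 1) \in unit_segment R.
Proof. by rewrite inE /unit_segment /= le_max lexx ge_max ler01 ge_min lexx orbT. Qed.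

(** A retraction of the line onto the segment: it yields points of the segment without proofs of
    bounds, and carries topological facts from the line to the segment. *)
Definition clamp (x : R) : unit_segment R := SigSub (clamp_subproof x).

Lemma clampK (s : unit_segment R) : clamp (\val s) = s.
Proof.
apply/val_inj => /=; have /andP[s0 s1] : 0 <= \val s <= 1 := set_valP s.
by rewrite (min_idPl s1) (max_idPr s0).
Qed.

Lemma clamp_continuous : continuous clamp.
Proof.
apply: set_type_continuous => x /=.
apply: (@continuous_max R R^o (fun=> 0) (fun y => Num.min y 1)); first exact: cvg_cst.
by apply: (@continuous_min R R^o id (fun=> 1)); [exact: cvg_id|exact: cvg_cst].
Qed.

(** The compact neighbourhood is the [clamp] image of a closed interval whose radius is half that of
    a ball inside the preimage of [N]. *)
Lemma unit_segment_locally_compact (s : unit_segment R) N : nbhs s N ->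
  exists C, [/\ nbhs s C, C `<=` N & compact C].
Proof.
move=> sN; have : nbhs (\val s) (clamp @^-1` N).
  by apply: clamp_continuous; rewrite clampK.
move=> /nbhs_ballP[e /= e0 eN].
pose I := `[\val s - e / 2, \val s + e / 2]%classic.
have e2 : 0 < e / 2 by rewrite divr_gt0.
exists (clamp @` I); split.
- have : nbhs s ((fun t : unit_segment R => \val t) @^-1` I).
    apply: set_val_continuous; apply/nbhs_ballP; exists (e / 2) => //= x.
    rewrite /ball /= distrC => /ltW; rewrite ler_distl /I /= in_itv /=.
    by rewrite lerBlDr.
  by apply: filterS => t It; exists (\val t) => //; rewrite clampK.
- move=> _ [x Ix <-]; apply: eN; rewrite /ball /= distrC.
  apply: le_lt_trans (_ : e / 2 < e); first by move: Ix; rewrite /I /= in_itv /= ler_distl.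
  by rewrite ltr_pdivrMr // ltr_pMr // ltr1n.
- apply: continuous_compact; last exact: segment_compact.
  exact/continuous_subspaceT/clamp_continuous.
Qed.

End UnitSegment.

(** * Points of cube complexes *)

(** Multiplication by [K] distributes over disjoint unions, so maps on points times the segment can
    be examined one cube at a time. *)
Lemma sigT_prod_continuous (I : choiceType) (T : I -> topologicalType)
    (K Z : topologicalType) (f : {i & T i} * K -> Z) :
  (forall i, continuous (fun x : T i * K => f (existT T i x.1, x.2))) ->
  continuous f.
Proof.
move=> cf [[i x] s] U /= fU.
have [[A B] /= [xA sB] AB] := cf i (x, s) U fU.
exists (existT T i @` A, B) => /=; first by split=> //; exact: existT_nbhs.
by move=> [_ t] [/= [y Ay <-] Bt]; exact: (AB (y, t)).
Qed.

Section CubePoints.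
Variables (R : realType) (X : cube_complex).
Local Open Scope ring_scope.
Implicit Types (c : cubes X) (p q : cube_points R X) (t : nat -> unit_segment R).

(* Coordinates are extended by 0 beyond the dimension, so that points of cubes
   of different dimensions are compared without casts. *)
Definition point_coord p (i : nat) : unit_segment R :=
  clamp (if insub i is Some j then coordinate (p := p) j else 0).

Definition cube_point c (u : unit_cube R (dim (\val c))) : cube_points R X :=
  existT (fun c : cubes X => unit_cube R (dim (\val c)) : topologicalType) c u.

Lemma point_row_subproof c t :
  (\row_(i < dim (\val c)) \val (t i)) \in unit_cube R (dim (\val c)).
Proof. by rewrite inE => i; rewrite mxE; exact: (set_valP (t i)). Qed.

Definition point_of c t : cube_points R X :=
  cube_point (SigSub (point_row_subproof c t)).

Lemma coordinateE p (i : 'I_(dim (\val (projT1 p)))) :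
  coordinate i = \val (point_coord p i).
Proof.
rewrite /point_coord valK.
by rewrite -[LHS](_ : \val (clamp (coordinate i)) = _) //;
  have /andP[h0 h1] := set_valP (projT2 p) i; rewrite /= (min_idPl h1) (max_idPr h0).
Qed.

Lemma point_coordE c t i : (i < dim (\val c))%N -> point_coord (point_of c t) i = t i.
Proof.
move=> ic; apply/val_inj.
by rewrite -[i]/(\val (Ordinal ic)) -(coordinateE (p := point_of c t)) /coordinate mxE.
Qed.

(** Replaces an equality in a dependent type by equalities of plain cubes and of the relevant
    coordinates. *)
Lemma eq_point_of c c' t t' : \val c = \val c' ->
  (forall i, (i < dim (\val c))%N -> t i = t' i) -> point_of c t = point_of c' t'.
Proof.
move=> /val_inj <- tt'; congr existT; apply/val_inj/rowP => i.
by rewrite !mxE tt'.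
Qed.

Lemma point_ofK p : point_of (projT1 p) (point_coord p) = p.
Proof.
case: p => c u; congr existT; apply/val_inj/rowP => i; rewrite mxE.
by rewrite -(coordinateE (p := existT _ c u)).
Qed.

Lemma cube_points_continuous (Z : topologicalType) (f : cube_points R X -> Z) :
  (forall c, continuous (fun u => f (@cube_point c u))) -> continuous f.
Proof.
by move=> cf [c u] U fU; exact: (cf c u U fU).
Qed.

Lemma point_of_continuous (Z : topologicalType) c (t : Z -> nat -> unit_segment R) :
  (forall i, continuous (fun z => t z i)) -> continuous (fun z => point_of c (t z)).
Proof.
move=> ct.
suff cu : continuous (fun z => SigSub (point_row_subproof c (t z)) : unit_cube R _).
  by move=> z U hU; exact: (cu z _ hU).
apply: set_type_continuous => z U /= [Q /= tQ QU].
have hQ (j : 'I_(dim (\val c))) : \forall y \near z, Q 0 j (\val (t y j)).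
  have cj : continuous (fun z => \val (t z j)).
    by move=> y; apply: continuous_comp; [exact: ct|exact: set_val_continuous].
  by apply: cj; have := tQ 0 j; rewrite mxE.
have : \forall y \near z, forall j : 'I_(dim (\val c)), Q 0 j (\val (t y j)).
  exact: filter_forall.
by apply: filterS => y Qy; apply: QU => i j; rewrite mxE ord1; exact: Qy.
Qed.

Lemma point_coord_continuous c i :
  continuous (fun u => point_coord (@cube_point c u) i).
Proof.
have [ic|ic] := ltnP i (dim (\val c)).
  rewrite (_ : (fun u => _) =
      fun u => clamp ((\val u : 'rV[R]_(dim (\val c))) 0 (Ordinal ic))).
    move=> u U /clamp_continuous /= hU.
    have h1 := @coord_continuous R _ _ 0 (Ordinal ic) (\val u) _ hU.
    exact: (@set_val_continuous _ _ u _ h1).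
  apply/funext => u; rewrite /point_coord insubT. by [].
rewrite (_ : (fun u => _) = fun=> clamp 0); first exact: cst_continuous.
by apply/funext => u; rewrite /point_coord insubF // ltnNge ic.
Qed.

(** Restatement without ordinals: [bump i] skips the index [i], whose coordinate is fixed on the
    face. *)
Lemma face_identificationP p q : face_identification p q <->
  exists i (e : bool), [/\ (i < dim (\val (projT1 q)))%N,
    \val (projT1 p) = face (\val (projT1 q)) i e,
    point_coord q i = clamp e%:R &
    forall j, (j < dim (\val (projT1 p)))%N ->
      point_coord p j = point_coord q (bump i j)].
Proof.
have clampe (e : bool) : \val (clamp (e%:R : R)) = e%:R.
  rewrite /=; case: e => /=.
    by rewrite minxx max_r.
  by rewrite min_l // maxxx.
split=> [[i [e [pq qi h]]]|[i [e [iq pq qi h]]]].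
  exists i, e; split=> //.
    by apply/val_inj; rewrite -coordinateE qi clampe.
  move=> j jp; apply/val_inj; have jq : (bump i j < dim (\val (projT1 q)))%N.
    have := dim_face e (ltn_ord i); rewrite -pq => dq; apply: leq_trans (_ : j.+2 <= _)%N.
      by rewrite /bump; case: (i <= j)%N.
    by rewrite -[leqRHS]dq.
  rewrite -[j in LHS]/(\val (Ordinal jp)) -[bump i j]/(\val (Ordinal jq)).
  by rewrite -!coordinateE; exact: h.
exists (Ordinal iq), e; split=> //.
  by rewrite coordinateE qi clampe.
by move=> j k kj; rewrite !coordinateE h // kj.
Qed.

End CubePoints.

Section PointMap.
Variables (R : realType) (X Y : cube_complex) (f : cube X -> cube Y).
Hypothesis f_map : combinatorial_map f.

Lemma map_cube_subproof (c : cubes X) : f (\val c) \in cubes Y.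
Proof. by rewrite inE; case: (f_map (set_valP c)). Qed.

Definition map_cube (c : cubes X) : cubes Y := SigSub (map_cube_subproof c).

Lemma dim_map_cube (c : cubes X) : dim (f (\val c)) = dim (\val c).
Proof. by case: (f_map (set_valP c)). Qed.

Lemma face_map_cube (c : cubes X) i e : i < dim (\val c) ->
  f (face (\val c) i e) = face (f (\val c)) i e.
Proof. by case: (f_map (set_valP c)) => _ _; apply. Qed.

Definition map_point (p : cube_points R X) : cube_points R Y :=
  point_of (map_cube (projT1 p)) (point_coord p).

Lemma map_point_of c (t : nat -> unit_segment R) :
  map_point (point_of c t) = point_of (map_cube c) t.
Proof.
by apply: eq_point_of => // i; rewrite /= dim_map_cube; exact: point_coordE.
Qed.

Lemma map_point_identification p q : face_identification p q ->
  face_identification (map_point p) (map_point q).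
Proof.
move=> /face_identificationP[i [e [iq pq qi h]]].
apply/face_identificationP; exists i, e; split => /=.
- by rewrite dim_map_cube.
- by rewrite pq face_map_cube.
- by rewrite point_coordE // dim_map_cube.
- move=> j; rewrite dim_map_cube => jp; rewrite !point_coordE ?dim_map_cube ?h //.
  rewrite -(dim_face e iq) -pq /bump; case: (i <= j) => //.
  exact: ltnW.
Qed.

Lemma map_point_continuous : continuous map_point.
Proof.
apply: cube_points_continuous => c.
apply: (point_of_continuous (c := map_cube c)
  (t := fun u => point_coord (@cube_point R X c u))) => i.
exact: point_coord_continuous.
Qed.

Lemma realizesP (x : realization R X) (y : realization R Y) : realizes f x y <->
  exists p, x = quotient_class _ p /\ y = quotient_class _ (map_point p).
Proof.
split=> [[p [q [xp yq qf h]]]|[p [-> ->]]].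
  exists p; split=> //; rewrite yq; congr quotient_class.
  rewrite -[q]point_ofK; apply: eq_point_of => //= i iq.
  have ip : i < dim (\val (projT1 p)) by rewrite -dim_map_cube -qf.
  apply/val_inj; have := h (Ordinal ip) (Ordinal iq) erefl.
  by rewrite !coordinateE.
exists p, (map_point p); split=> // i j ij.
by rewrite !coordinateE point_coordE ?ij // dim_map_cube -ij.
Qed.

End PointMap.

(** * Realization of a graph of spaces *)

Lemma ltn_bump i j n : j < n -> bump i j < n.+1.
Proof. by rewrite /bump; case: leqP; lia. Qed.

Lemma ltn_unbump k j n : k <= n -> j <= n -> j != k -> unbump k j < n.
Proof. by rewrite /unbump; case: (ltnP k j); lia. Qed.

Section InsertCoordinate.
Variable T : Type.
Implicit Types (u : nat -> T) (t : T).

(** Here [t] is the parameter along the segment and [k] its place among the coordinates of the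
    crossed cube; precomposition with [bump k] forgets it. *)
Definition insert_coord k t u (j : nat) : T := if j == k then t else u (unbump k j).

Lemma insert_coord_pos k t u : insert_coord k t u k = t.
Proof. by rewrite /insert_coord eqxx. Qed.

Lemma insert_coord_bump k t u j : insert_coord k t u (bump k j) = u j.
Proof. by rewrite /insert_coord eq_sym (negbTE (neq_bump k j)) bumpK. Qed.

Lemma insert_coordK k u j : insert_coord k (u k) (u \o bump k) j = u j.
Proof.
by rewrite /insert_coord; case: eqP => [->//|/eqP jk] /=; rewrite unbumpKcond (negbTE jk).
Qed.

(** The cubical identity for coordinates: [unbump i k] is the place of the segment coordinate after
    passing to a face of index [i] of the edge-space cube, as in [pos_face]. *)
Lemma insert_coord_face k i t u j :
  insert_coord k t u (bump (bump k i) j) =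
  insert_coord (unbump i k) t (u \o bump i) j.
Proof.
rewrite /insert_coord; have -> : (bump (bump k i) j == k) = (j == unbump i k).
  apply/eqP/eqP; rewrite /bump /unbump; do ?case: leqP => ?; lia.
case: eqP => // jk /=; congr (u _).
by move: jk; rewrite /bump /unbump; do ?case: leqP => ?; lia.
Qed.

End InsertCoordinate.

(* Cutting X along the midcubes of the cubes [mid e c]: each cube of X either
   lies in exactly one vertex space or is the product of a cube of exactly one
   edge space with a segment, inserted as the coordinate number [pos e c]. *)
Section Decomposition.
Variables (R : realType) (G : space_graph) (X : cube_complex).
Variable incl : forall x : graph_vertex G, cube (vertex_space x) -> cube X.
Variable mid : forall e : graph_edge G, cube (edge_space e) -> cube X.
Variable pos : forall e : graph_edge G, cube (edge_space e) -> nat.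
Arguments mid : clear implicits.
Arguments pos : clear implicits.

Hypothesis incl_map : forall x, combinatorial_map (incl (x := x)).
Hypothesis glue_map : forall e b, combinatorial_map (@glue G e b).
Hypothesis mid_cubes : forall e c, cubes (edge_space e) c -> cubes X (mid e c).
Hypothesis dim_mid : forall e c, cubes (edge_space e) c -> dim (mid e c) = (dim c).+1.
Hypothesis pos_dim : forall e c, cubes (edge_space e) c -> pos e c <= dim c.
Hypothesis pos_face : forall e c i b, cubes (edge_space e) c -> i < dim c ->
  pos e (face c i b) = unbump i (pos e c).
Hypothesis face_mid_pos : forall e c b, cubes (edge_space e) c ->
  face (mid e c) (pos e c) b = incl (@glue G e b c).
Hypothesis face_mid : forall e c i b, cubes (edge_space e) c -> i < dim c ->
  face (mid e c) (bump (pos e c) i) b = mid e (face c i b).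
Hypothesis cube_cases : forall c, cubes X c ->
  (exists x (c' : cubes (vertex_space x)), incl (\val c') = c) \/
  (exists e (c' : cubes (edge_space e)), mid e (\val c') = c).
Hypothesis incl_inj : forall x x' (c : cubes (vertex_space x))
  (c' : cubes (vertex_space x')), incl (\val c) = incl (\val c') ->
  existT (fun x => set_type (cubes (vertex_space x))) x c = existT _ x' c'.
Hypothesis mid_inj : forall e e' (c : cubes (edge_space e))
  (c' : cubes (edge_space e')), mid e (\val c) = mid e' (\val c') ->
  existT (fun e => set_type (cubes (edge_space e))) e c = existT _ e' c'.
Hypothesis incl_mid : forall x e (c : cubes (vertex_space x))
  (c' : cubes (edge_space e)), incl (\val c) <> mid e (\val c').

Local Notation vertex_class s :=
  (quotient_class (@graph_identification R G) (vertex_point s)).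
Local Notation edge_class s t :=
  (quotient_class (@graph_identification R G) (edge_point s t)).
Local Notation point_class p := (quotient_class (@face_identification R X) p).

Lemma mid_cube_subproof e (c : cubes (edge_space e)) : mid e (\val c) \in cubes X.
Proof. by rewrite inE; apply: mid_cubes; exact: set_valP. Qed.

Definition mid_cube e (c : cubes (edge_space e)) : cubes X :=
  SigSub (mid_cube_subproof c).

Definition mid_point e (t : unit_segment R) (p : cube_points R (edge_space e)) :
    cube_points R X :=
  point_of (mid_cube (projT1 p))
    (insert_coord (pos e (\val (projT1 p))) t (point_coord p)).

Lemma mid_point_of e t c (u : nat -> unit_segment R) :
  mid_point t (point_of c u) =
  point_of (mid_cube (e := e) c) (insert_coord (pos e (\val c)) t u).
Proof.
have cE := set_valP c.
apply: eq_point_of => // j /=; rewrite dim_mid // ltnS => jc.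
rewrite /insert_coord; case: eqP => // /eqP jk; apply: point_coordE => /=.
exact: ltn_unbump (pos_dim cE) jc jk.
Qed.

Lemma mid_point_identification e t (p q : cube_points R (edge_space e)) :
  face_identification p q -> face_identification (mid_point t p) (mid_point t q).
Proof.
have pE := set_valP (projT1 p); have qE := set_valP (projT1 q).
move=> /face_identificationP[i [b [iq pq qi h]]].
have iq' : bump (pos e (\val (projT1 q))) i < (dim (\val (projT1 q))).+1.
  exact: ltn_bump.
have dp := dim_face b iq; rewrite -pq in dp.
apply/face_identificationP; exists (bump (pos e (\val (projT1 q))) i), b.
split=> /=; rewrite ?dim_mid //; first by rewrite pq face_mid.
  by rewrite point_coordE ?insert_coord_bump //= dim_mid.
move=> j; rewrite ltnS => jp; rewrite !point_coordE /= ?dim_mid //.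
- rewrite insert_coord_face pq pos_face // /insert_coord; case: eqP => //= /eqP jk.
  apply: h; apply: ltn_unbump => //.
  by have := pos_dim pE; rewrite pq pos_face // -pq.
- by apply: ltn_bump; rewrite -dp ltnS.
Qed.

Lemma mid_point_continuous e :
  continuous (fun x : cube_points R (edge_space e) * unit_segment R =>
    mid_point x.2 x.1).
Proof.
apply: sigT_prod_continuous => c.
apply: (point_of_continuous (c := mid_cube c) (t := fun x =>
  insert_coord (pos e (\val c)) x.2 (point_coord (@cube_point R _ c x.1)))) => j.
rewrite /insert_coord; case: eqP => _; first by move=> x; exact: cvg_snd.
move=> [u s] U hU; have := @point_coord_continuous R _ c (unbump (pos e (\val c)) j) u U hU.
move=> hu; exists ((fun v => point_coord (@cube_point R _ c v) (unbump (pos e (\val c)) j)) @^-1` U, setT).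
  by split=> //=; exact: filterT.
by move=> [v r] [].
Qed.

(** At an end of the segment the inserted coordinate is 0 or 1, so the point lies on the face that
    [face_mid_pos] places in a vertex-space. *)
Lemma mid_point_glue e (b : bool) t (p : cube_points R (edge_space e)) : t = clamp b%:R%R ->
  face_identification
    (map_point (incl_map (x := ends e b)) (map_point (glue_map (e := e) b) p))
    (mid_point t p).
Proof.
have pE := set_valP (projT1 p) => tb.
apply/face_identificationP; exists (pos e (\val (projT1 p))), b; split=> /=.
- by rewrite dim_mid // ltnS pos_dim.
- by rewrite face_mid_pos.
- by rewrite point_coordE /= ?insert_coord_pos // dim_mid // ltnS pos_dim.
- have dg := dim_map_cube (glue_map (e := e) b) (projT1 p).
  move=> j; rewrite (dim_map_cube (incl_map (x := _)) (map_cube _ _)) /= dg => jp.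
  rewrite !point_coordE /= ?dg ?dim_mid ?insert_coord_bump //.
    exact: ltn_bump.
  by rewrite (dim_map_cube (incl_map (x := _)) (map_cube _ _)) /= dg.
Qed.

Definition piece_lift (i : graph_vertex G + graph_edge G) :
    graph_piece R i -> realization R X :=
  match i with
  | inl x => quotient_lift (fun p => point_class (map_point (incl_map (x := x)) p))
  | inr e => fun z => quotient_lift (fun p => point_class (mid_point z.2 p)) z.1
  end.

Definition to_complex (z : graph_points R G) : realization R X :=
  piece_lift (projT2 z).

Lemma to_complex_vertex x p :
  to_complex (vertex_point (quotient_class _ p)) =
  point_class (map_point (incl_map (x := x)) p).
Proof.
apply: quotient_liftE => q r /(map_point_identification (incl_map (x := x))) qr.
exact/quotient_classP/rst_step.
Qed.

Lemma to_complex_edge e (p : cube_points R (edge_space e)) t :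
  to_complex (edge_point (quotient_class _ p) t) = point_class (mid_point t p).
Proof.
apply: quotient_liftE => q r /(mid_point_identification t) qr.
exact/quotient_classP/rst_step.
Qed.

Lemma to_complex_continuous : continuous to_complex.
Proof.
have cq := @quotient_class_continuous _ (@face_identification R X).
suff h i : continuous (@piece_lift i).
  by move=> [i z] U hU; exact: (h i z U hU).
case: i => [x|e].
  apply: quotient_lift_continuous => [p q /(map_point_identification (incl_map (x := x))) pq|].
    exact/quotient_classP/rst_step.
  by move=> p; apply: continuous_comp; [exact: map_point_continuous|exact: cq].
(* An edge piece is a quotient times a segment; continuity can be tested before the quotient is
   taken because the segment is locally compact. *)
apply: quotient_product_continuous; first exact: unit_segment_locally_compact.
rewrite (_ : (fun z => _) = fun z => point_class (mid_point z.2 z.1)).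
  by move=> z; apply: continuous_comp; [exact: mid_point_continuous|exact: cq].
by apply/funext => -[p t]; exact: to_complex_edge.
Qed.

Lemma to_complex_identification y z :
  graph_identification y z -> to_complex y = to_complex z.
Proof.
case=> e b s s' t tb /(realizesP (glue_map (e := e) b))[p [-> ->]].
rewrite to_complex_edge to_complex_vertex; apply/quotient_classP/rst_sym/rst_step.
by apply: mid_point_glue; rewrite -tb clampK.
Qed.

Lemma cube_dec_subproof (c : cubes X) :
  {y : {x & set_type (cubes (vertex_space x))} + {e & set_type (cubes (edge_space e))} |
    match y with
    | inl (existT x c') => incl (\val c') = \val c
    | inr (existT e c') => mid e (\val c') = \val c
    end}.
Proof.
apply: cid; have [[x [c' cE]]|[e [c' cE]]] := cube_cases (set_valP c).
  by exists (inl (existT _ x c')).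
by exists (inr (existT _ e c')).
Qed.

(** The choice is forced: [incl_inj], [mid_inj] and [incl_mid] leave only one possible value. *)
Definition cube_dec c := proj1_sig (cube_dec_subproof c).

Lemma cube_dec_incl x (c : cubes (vertex_space x)) :
  cube_dec (map_cube (incl_map (x := x)) c) = inl (existT _ x c).
Proof.
rewrite /cube_dec; case: cube_dec_subproof => -[[x' c']|[e c']] /= E.
  by congr inl; exact: incl_inj.
by case: (incl_mid (esym E)).
Qed.

Lemma cube_dec_mid e (c : cubes (edge_space e)) :
  cube_dec (mid_cube c) = inr (existT _ e c).
Proof.
rewrite /cube_dec; case: cube_dec_subproof => -[[x' c']|[e' c']] /= E.
  by case: (incl_mid E).
by congr inr; exact: mid_inj.
Qed.

Definition to_graph (p : cube_points R X) : graph_realization R G :=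
  match cube_dec (projT1 p) with
  | inl (existT x c) => vertex_class (quotient_class _ (point_of c (point_coord p)))
  | inr (existT e c) =>
      edge_class (quotient_class _ (point_of c (point_coord p \o bump (pos e (\val c)))))
        (point_coord p (pos e (\val c)))
  end.

Lemma to_graph_incl x (c : cubes (vertex_space x)) t :
  to_graph (point_of (map_cube (incl_map (x := x)) c) t) =
  vertex_class (quotient_class _ (point_of c t)).
Proof.
rewrite /to_graph /= cube_dec_incl; congr (vertex_class (quotient_class _ _)).
by apply: eq_point_of => // i ic; rewrite point_coordE //= dim_map_cube.
Qed.

Lemma to_graph_mid e (c : cubes (edge_space e)) t :
  to_graph (point_of (mid_cube c) t) =
  edge_class (quotient_class _ (point_of c (t \o bump (pos e (\val c)))))
    (t (pos e (\val c))).
Proof.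
have cE := set_valP c; have ck := pos_dim cE.
rewrite /to_graph /= cube_dec_mid point_coordE /= ?dim_mid //.
congr (edge_class (quotient_class _ _) _).
by apply: eq_point_of => // i ic /=; rewrite point_coordE //= dim_mid // ltn_bump.
Qed.

Lemma cube_point_cases (p : cube_points R X) :
  (exists x (c : cubes (vertex_space x)),
    p = point_of (map_cube (incl_map (x := x)) c) (point_coord p)) \/
  (exists e (c : cubes (edge_space e)), p = point_of (mid_cube c) (point_coord p)).
Proof.
have [[x [c cE]]|[e [c cE]]] := cube_cases (set_valP (projT1 p)); [left|right].
  by exists x, c; rewrite -{1}[p]point_ofK; apply: eq_point_of.
by exists e, c; rewrite -{1}[p]point_ofK; apply: eq_point_of.
Qed.

Lemma to_graph_identification p q :
  face_identification p q -> to_graph p = to_graph q.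
Proof.
move=> /face_identificationP[i [b [iq pq qi h]]].
have [[x [c qE]]|[e [c qE]]] := cube_point_cases q.
  (* The larger cube lies in a vertex-space, and so does its face. *)
  have cV := set_valP c.
  have qc : \val (projT1 q) = incl (\val c) by rewrite qE.
  rewrite qc dim_map_cube // in iq; rewrite qc -face_map_cube // in pq.
  have fV : face (\val c) i b \in cubes (vertex_space x).
    by rewrite inE; exact: face_cubes.
  pose c' : cubes (vertex_space x) := SigSub fV.
  have pE : p = point_of (map_cube (incl_map (x := x)) c') (point_coord p).
    by rewrite -{1}[p]point_ofK; exact: eq_point_of.
  have dp : dim (\val (projT1 p)) = dim (\val c') by rewrite pE; exact: dim_map_cube.
  rewrite qE pE !to_graph_incl; congr quotient_class; congr vertex_point.
  apply/quotient_classP/rst_step/face_identificationP; exists i, b; split=> //=.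
    by rewrite point_coordE.
  move=> j jc; rewrite !point_coordE //; last by rewrite -(dim_face b iq) ltn_bump.
  by apply: h; rewrite dp.
have cE := set_valP c.
have qc : \val (projT1 q) = mid e (\val c) by rewrite qE.
rewrite qc dim_mid // in iq; rewrite qc in pq.
(* If the face is an end of the segment, [p] lies in a vertex-space and the identification is a
   gluing. *)
have [ik|ik] := eqVneq i (pos e (\val c)).
  rewrite ik face_mid_pos // in pq.
  pose c' := map_cube (glue_map (e := e) b) c.
  have pE : p = point_of (map_cube (incl_map (x := ends e b)) c') (point_coord p).
    by rewrite -{1}[p]point_ofK; exact: eq_point_of.
  have dp : dim (\val (projT1 p)) = dim (\val c).
    rewrite pE; apply: etrans (dim_map_cube (glue_map (e := e) b) c).
    exact: (dim_map_cube (incl_map (x := ends e b)) c').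
  rewrite qE pE to_graph_incl to_graph_mid; apply/esym/quotient_classP/rst_step.
  apply: (@GraphIdentification R G e b); first by rewrite -ik qi; case: (b) => /=;
    rewrite ?minxx ?(min_idPl ler01) ?maxxx // max_r.
  apply/(realizesP (glue_map (e := e) b)).
  exists (point_of c (point_coord q \o bump (pos e (\val c)))); split=> //.
  congr quotient_class; rewrite map_point_of; apply: eq_point_of => // j.
  by rewrite (dim_map_cube (glue_map (e := e) b) c) /= -ik => jc; rewrite h // dp.
(* Otherwise the face runs along the segment: [p] and [q] stay in one edge piece with the same
   segment parameter, and the identification happens in the edge-space. *)
have ic : unbump (pos e (\val c)) i < dim (\val c).
  by apply: ltn_unbump => //; exact: pos_dim.
have iE : i = bump (pos e (\val c)) (unbump (pos e (\val c)) i).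
  by rewrite unbumpKcond (negbTE ik).
rewrite iE face_mid // in pq.
have fE : face (\val c) (unbump (pos e (\val c)) i) b \in cubes (edge_space e).
  by rewrite inE; exact: face_cubes.
pose c' : cubes (edge_space e) := SigSub fE.
have pE : p = point_of (mid_cube c') (point_coord p).
  by rewrite -{1}[p]point_ofK; exact: eq_point_of.
have dc' := dim_face b ic.
have dp : dim (\val (projT1 p)) = dim (\val c).
  by rewrite pE -dc'; apply: dim_mid; exact: set_valP.
rewrite qE pE !to_graph_mid.
have kE : point_coord p (pos e (\val c')) = point_coord q (pos e (\val c)).
  rewrite h; last by rewrite dp -dc' ltnS; apply: pos_dim; exact: set_valP.
  congr point_coord; rewrite /= pos_face // {1}iE /bump /unbump.
  by do ?case: leqP => ?; lia.
rewrite kE; congr quotient_class; congr edge_point.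
apply/quotient_classP/rst_step/face_identificationP.
exists (unbump (pos e (\val c)) i), b; split=> //=.
  by rewrite point_coordE //= -iE.
move=> j jc; rewrite !point_coordE //=; last by rewrite -dc' ltn_bump.
rewrite h; last by rewrite dp -dc' ltn_bump.
congr point_coord; rewrite /= pos_face // {1}iE /bump /unbump.
by do ?case: leqP => ?; lia.
Qed.

Lemma to_graph_continuous : continuous to_graph.
Proof.
have cq := @quotient_class_continuous _ (@graph_identification R G).
apply: cube_points_continuous => c; rewrite /to_graph /=.
have cc i := @point_coord_continuous R X c i.
(* The case depends on the cube alone, so a single formula holds on the whole cube. *)
case: (cube_dec c) => -[].
  move=> x c'.
  have cp : continuous (fun u => point_of c' (point_coord (@cube_point R X c u))).
    by apply: point_of_continuous => i; exact: cc.
  move=> u U /cq hU.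
  have h1 := @existT_continuous _ (@graph_piece R G) (inl x) _ _ hU.
  have h2 := @quotient_class_continuous _ (@face_identification R _) _ _ h1.
  exact: (cp _ _ h2).
move=> e c'.
have cp : continuous (fun u => point_of c'
    (point_coord (@cube_point R X c u) \o bump (pos e (\val c')))).
  by apply: point_of_continuous => i; exact: cc.
move=> u U /cq hU.
have := @existT_continuous _ (@graph_piece R G) (inr e) _ _ hU.
move=> [[A B] /= [hA hB] AB].
have h1 : nbhs u (fun v => B (point_coord (@cube_point R X c v) (pos e (\val c')))).
  exact: (cc _ _ _ hB).
have h2 : nbhs u (fun v => A (quotient_class _ (point_of c'
    (point_coord (@cube_point R X c v) \o bump (pos e (\val c')))))).
  exact: (cp _ _ (@quotient_class_continuous _ (@face_identification R _) _ _ hA)).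
apply: filterS (filterI h1 h2) => v [/= Bv Av].
exact: (AB (_, _)).
Qed.

Lemma graph_decomposition : @decomposition R G X incl.
Proof.
exists (quotient_lift to_complex), (quotient_lift to_graph).
have hE z := quotient_liftE to_complex_identification z.
have gE p := quotient_liftE to_graph_identification p.
split.
- move=> z; rewrite -[z]quotient_class_repr hE.
  case: (repr z) => -[x s|e [s t]]; rewrite -[s]quotient_class_repr.
    by rewrite to_complex_vertex gE -[repr s]point_ofK map_point_of to_graph_incl.
  rewrite to_complex_edge gE -[repr s]point_ofK mid_point_of to_graph_mid.
  rewrite insert_coord_pos; congr (edge_class (quotient_class _ _) _).
  by apply: eq_point_of => // i _ /=; rewrite insert_coord_bump.
- move=> y; rewrite -[y]quotient_class_repr gE.
  have [[x [c ->]]|[e [c ->]]] := cube_point_cases (repr y).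
    by rewrite to_graph_incl hE to_complex_vertex map_point_of.
  rewrite to_graph_mid hE to_complex_edge mid_point_of; congr quotient_class.
  by apply: eq_point_of => // i _; rewrite insert_coordK.
- by apply: quotient_lift_continuous; [exact: to_complex_identification|exact: to_complex_continuous].
- by apply: quotient_lift_continuous; [exact: to_graph_identification|exact: to_graph_continuous].
- move=> x s; rewrite hE -[s]quotient_class_repr to_complex_vertex.
  by apply/realizesP; exists (repr s).
Qed.

End Decomposition.

(** * Normal forms of sequences of rewriting steps *)

(* A step [(n, (u, v))] replaces the factor u at position n of a word by v.
   Since the ambient word is not recorded, steps are unchanged by right
   multiplication of the word, and merely translated by left multiplication. *)
Section Steps.
Variable Sigma : choiceType.
Local Notation word := (seq Sigma).
Definition step : Type := nat * (word * word).
Implicit Types (x y z o : step) (p q : seq step).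

Definition step_rev x : step := (x.1, (x.2.2, x.2.1)).
Definition left_of x o := x.1 + size x.2.1 <= o.1.
(** The step [o] when [x], originally performed after it and to its left, is performed first. Under
    [left_of x o] the subtraction does not truncate. *)
Definition step_after x o : step := (o.1 - size x.2.1 + size x.2.2, o.2).
Definition step_shift n x : step := (n + x.1, x.2).
Definition proper_step x := (0 < size x.2.1) && (0 < size x.2.2).
(** For [y] performed right after [x]: it neither undoes [x] nor can be moved in front of it. *)
Definition reduced_pair x y := (y != step_rev x) && ~~ left_of y x.

(* The reduced sequence of a product [o :: p] with p reduced: o is pushed to the
   right through the steps taking place on its left, until it cancels or is
   blocked. *)
Fixpoint insert_step o p : seq step :=
  if p is x :: p' then
    if x == step_rev o then p'
    else if left_of x o then x :: insert_step (step_after x o) p'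
    else o :: p
  else [:: o].

Definition reduce p := foldr insert_step [::] p.

Lemma step_revK : involutive step_rev.
Proof. by case=> [? []]. Qed.

Lemma all_proper_insert o p : proper_step o -> all proper_step p ->
  all proper_step (insert_step o p).
Proof.
elim: p o => [|x p ih] o /=; first by move=> ->.
move=> go /andP[gx gp]; case: ifP => // _; case: ifP => _ /=; first by rewrite gx ih.
by rewrite go gx.
Qed.

Lemma all_proper_reduce p : all proper_step p -> all proper_step (reduce p).
Proof. by elim: p => //= x p ih /andP[gx /ih]; exact: all_proper_insert. Qed.

Lemma reduced_pair_follows x o : proper_step x -> proper_step o ->
  x.1 + size x.2.2 <= o.1 -> reduced_pair x o.
Proof.
rewrite /proper_step /reduced_pair /left_of => /andP[? ?] /andP[? ?] ?.
by apply/andP; split; [apply/eqP => E; move: E (congr1 fst E) => /= _|]; lia.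
Qed.

(** The invariant while [o] travels: it always starts at or beyond the end of the output of the step
    just passed, hence cannot interfere with it. *)
Lemma path_insert_step x o p : proper_step x -> proper_step o -> all proper_step p ->
  x.1 + size x.2.2 <= o.1 -> path reduced_pair x p ->
  path reduced_pair x (insert_step o p).
Proof.
elim: p x o => [|y p ih] x o gx go /=.
  by move=> _ xo _; rewrite reduced_pair_follows.
move=> /andP[gy gp] xo /andP[xy yp]; case: eqP => [E|/eqP yo].
  (* When [y] cancels [o], the next step [z] is not left of [y], so it ends beyond the position of
     [o], hence beyond the output of [x]; it can neither undo [x] nor precede it. *)
  case: p {ih} gp yp => //= z p /andP[gz gp] /andP[/andP[_ yz] ->]; rewrite andbT.
  move: gz yz xo; rewrite E /proper_step /reduced_pair /left_of /= => gz yz xo.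
  by apply/andP; split; [apply/eqP => Ez; move: yz; rewrite Ez /=|]; lia.
case: ifP => yl /=.
  by rewrite xy ih // /step_after /=; move: yl; rewrite /left_of; lia.
by rewrite reduced_pair_follows // yp {1}/reduced_pair yo yl.
Qed.

Lemma sorted_insert_step o p : proper_step o -> all proper_step p ->
  sorted reduced_pair p -> sorted reduced_pair (insert_step o p).
Proof.
case: p => [//|x p] go /= /andP[gx gp] xp; case: eqP => [_|/eqP xo].
  exact: path_sorted xp.
case: ifP => xl /=; last by rewrite xp andbT /reduced_pair xo xl.
by apply: path_insert_step => //; move: xl; rewrite /left_of /=; lia.
Qed.

Lemma sorted_reduce p : all proper_step p -> sorted reduced_pair (reduce p).
Proof.
elim: p => //= x p ih /andP[gx gp]; apply: sorted_insert_step => //; last exact: ih.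
exact: all_proper_reduce.
Qed.

Lemma insert_step_head o p : path reduced_pair o p -> insert_step o p = o :: p.
Proof. by case: p => //= x p /andP[/andP[/negbTE -> /negbTE ->]]. Qed.

(** Applied also to [step_rev o], this says that each proper step permutes the reduced sequences;
    invariance of [reduce] under backtracks follows. *)
Lemma insert_step_rev o p : proper_step o -> all proper_step p ->
  sorted reduced_pair p -> insert_step o (insert_step (step_rev o) p) = p.
Proof.
elim: p o => [|x p ih] o go /=; first by rewrite eqxx.
move=> /andP[gx gp] xp; rewrite step_revK; case: eqP => [E|/eqP xo].
  by rewrite -E; exact: insert_step_head.
have -> : left_of x (step_rev o) = left_of x o by [].
case: ifP => xl /=; last by rewrite eqxx.
have /negbTE-> : x != step_rev o.
  apply/eqP => E; move: go xl; rewrite E /proper_step /left_of /=; lia.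
rewrite xl; congr cons.
have -> : step_after x (step_rev o) = step_rev (step_after x o) by [].
by apply: ih => //; exact: path_sorted xp.
Qed.

(** The square relation for the action on reduced sequences. The induction on [p] distinguishes
    whether its head cancels [x], passes to the left of [x], or blocks it. *)
Lemma insert_step_swap x o p : proper_step x -> proper_step o -> all proper_step p ->
  sorted reduced_pair p -> left_of x o ->
  insert_step o (insert_step x p) = insert_step x (insert_step (step_after x o) p).
Proof.
elim: p x o => [|y p ih] x o gx go /=.
  move=> _ _ xo; rewrite xo /=.
  have /negbTE-> : x != step_rev o.
    by apply/eqP => E; move: gx xo; rewrite E /proper_step /left_of /=; lia.
  have /andP[/negbTE-> /negbTE-> //] : reduced_pair x (step_after x o).
  by apply: reduced_pair_follows => //=; move: xo; rewrite /left_of /=; lia.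
move=> /andP[gy gp] yp xo.
have /negbTE xro : x != step_rev o.
  by apply/eqP => E; move: gx xo; rewrite E /proper_step /left_of /=; lia.
have [yx|yx] := eqVneq y (step_rev x).
  (* The head undoes [x]: moving [o] through [x] and then through its inverse restores its
     position. *)
  have yo : left_of y (step_after x o).
    by move: xo; rewrite yx /left_of /step_after /=; lia.
  have /negbTE-> : y != step_rev (step_after x o).
    by apply/eqP => E; move: gy yo; rewrite E /proper_step /left_of /=; lia.
  rewrite yo /= yx eqxx; congr (insert_step _ p).
  by case: (o) xo => n r; rewrite /left_of /step_after /= => xo; congr (_, _); lia.
have [ylx|ylx] := boolP (left_of y x).
  (* The head is left of [x], hence of [o], and passes both; the positions obtained in the two
     orders agree. *)
  have yo : left_of y (step_after x o).
    by move: xo ylx; rewrite /left_of /step_after /=; lia.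
  have ylo : left_of y o by move: xo ylx; rewrite /left_of /=; lia.
  have /negbTE-> : y != step_rev (step_after x o).
    by apply/eqP => E; move: gy yo; rewrite E /proper_step /left_of /=; lia.
  have /negbTE yro : y != step_rev o.
    by apply/eqP => E; move: gy ylo; rewrite E /proper_step /left_of /=; lia.
  rewrite yo /= yro ylo (negbTE yx) ylx; congr cons.
  have -> : step_after y (step_after x o) = step_after (step_after y x) (step_after y o).
    by rewrite /step_after /=; congr (_, _); move: xo ylx; rewrite /left_of; lia.
  apply: ih => //; first exact: path_sorted yp.
  by move: xo ylx; rewrite /left_of /step_after /=; lia.
rewrite /= xro xo.
(* The head blocks [x], and [o] moved behind [x] stays to the right of its output, so [x] remains
   first. *)
apply/esym/insert_step_head.
apply: (@path_insert_step x (step_after x o) (y :: p)) => //=.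
- by rewrite gy.
- by move: xo; rewrite /left_of /step_after /=; lia.
- by rewrite yp andbT /reduced_pair yx.
Qed.

Lemma reduce_cat p q : reduce (p ++ q) = foldr insert_step (reduce q) p.
Proof. exact: foldr_cat. Qed.

Lemma reduce_backtrack p q o : proper_step o -> all proper_step q ->
  reduce (p ++ [:: o; step_rev o] ++ q) = reduce (p ++ q).
Proof.
move=> go gq; rewrite !reduce_cat /=; congr foldr.
by apply: insert_step_rev => //; [exact: all_proper_reduce|exact: sorted_reduce].
Qed.

Lemma reduce_swap p q x o : proper_step x -> proper_step o -> all proper_step q ->
  left_of x o ->
  reduce (p ++ [:: o; x] ++ q) = reduce (p ++ [:: x; step_after x o] ++ q).
Proof.
move=> gx go gq xo; rewrite !reduce_cat /=; congr foldr.
by apply: insert_step_swap => //; [exact: all_proper_reduce|exact: sorted_reduce].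
Qed.

Lemma step_shift_inj n : injective (step_shift n).
Proof. by move=> [i r] [j s] [/addnI -> ->]. Qed.

(** The tests only compare positions, so they do not see a common translation; in the branch that
    uses [step_after] the subtraction is exact. *)
Lemma insert_step_shift n o p : insert_step (step_shift n o) (map (step_shift n) p) =
  map (step_shift n) (insert_step o p).
Proof.
elim: p o => //= x p ih o.
have -> : (step_shift n x == step_rev (step_shift n o)) = (x == step_rev o).
  exact: (inj_eq (@step_shift_inj n) x (step_rev o)).
case: ifP => // _.
have -> : left_of (step_shift n x) (step_shift n o) = left_of x o.
  by rewrite /left_of /= -addnA leq_add2l.
case: ifP => //= xo; rewrite -ih; congr (_ :: insert_step _ _).
by rewrite /step_after /step_shift /=; congr (_, _); move: xo; rewrite /left_of; lia.
Qed.

Lemma reduce_shift n p : reduce (map (step_shift n) p) = map (step_shift n) (reduce p).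
Proof. by elim: p => //= x p ->; exact: insert_step_shift. Qed.

End Steps.

(** * Homotopy of edge paths *)

Section Homotopy.
Variable X : cube_complex.
Implicit Types (x y z : cube X) (o : oriented_edge X) (p q : seq (oriented_edge X)).

Lemma reverseK : involutive (@reverse X).
Proof. by case=> c b; rewrite /reverse /= negbK. Qed.

Lemma terminus_reverse o : terminus (reverse o) = origin o.
Proof. by rewrite /terminus /= negbK. Qed.

Lemma edge_path_catP x p q z : edge_path X x (p ++ q) z ->
  exists y, edge_path X x p y /\ edge_path X y q z.
Proof.
elim: p x => [|o p ih] x /=; first by exists x.
by move=> [eo ox /ih[y [py qz]]]; exists y.
Qed.

Lemma homotopic_edge_path x y p q :
  homotopic X x y p q -> edge_path X x p y <-> edge_path X x q y.
Proof. by elim=> [? ? []|//|? ? _ ->|? ? ? _ -> _ ->]. Qed.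

Lemma homotopic_sym x y p q : homotopic X x y p q -> homotopic X x y q p.
Proof. exact: rst_sym. Qed.

Lemma homotopic_trans x y p q r :
  homotopic X x y p q -> homotopic X x y q r -> homotopic X x y p r.
Proof. exact: rst_trans. Qed.

Lemma homotopic_catl x y z p q q' : edge_path X x p y ->
  homotopic X y z q q' -> homotopic X x z (p ++ q) (p ++ q').
Proof.
move=> hp h; have hz : edge_path X z [::] z by [].
by have := homotopic_cat hp hz h; rewrite !cats0.
Qed.

Lemma homotopic_catr x y z p p' q : edge_path X y q z ->
  homotopic X x y p p' -> homotopic X x z (p ++ q) (p' ++ q).
Proof. by move=> hq h; have := homotopic_cat (erefl : edge_path X x [::] x) hq h. Qed.

Lemma homotopic_backtrack o : edge o.1 ->
  homotopic X (origin o) (origin o) [:: o; reverse o] [::].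
Proof.
move=> eo; apply: rst_step; split=> //=; first by rewrite terminus_reverse.
exact: (@homotopy_backtrack X [::] [::] o eo).
Qed.

Lemma homotopic_backtrack' o : edge o.1 ->
  homotopic X (terminus o) (terminus o) [:: reverse o; o] [::].
Proof. by move=> eo; have := @homotopic_backtrack (reverse o) eo; rewrite reverseK. Qed.

(** Turns a square relation by one corner: from ab = cd follows a^-1 c = b d^-1. It supplies the
    orientations missing from [homotopy_square]. *)
Lemma homotopic_rotate x y a b c d :
  edge_path X x [:: a; b] y -> edge_path X x [:: c; d] y ->
  homotopic X x y [:: a; b] [:: c; d] ->
  homotopic X (terminus a) (terminus c) [:: reverse a; c] [:: b; reverse d].
Proof.
move=> /= [ea ax [eb ba yb]] [ec cx [ed dc yd]] h.
have pa : edge_path X (terminus a) [:: reverse a] x by split=> //=; rewrite terminus_reverse.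
have pd : edge_path X y [:: reverse d] (terminus c).
  by split=> //=; rewrite terminus_reverse.
have pc : edge_path X (terminus a) [:: reverse a; c] (terminus c).
  by split=> //; split=> //; rewrite terminus_reverse ax.
have bt := @homotopic_backtrack d ed; rewrite dc in bt.
apply: rst_trans (rst_sym _ _ _ _ (homotopic_catl pc bt)) _.
have := homotopic_cat pa pd h => /= /(rst_sym _ _ _ _) h'.
apply: rst_trans h' _.
apply: (@homotopic_catr _ (terminus a) _ [:: reverse a; a] [::]).
  by do 2![split=> //]; [exact: etrans yd (esym yb)|rewrite terminus_reverse].
exact: homotopic_backtrack'.
Qed.

Lemma edge_square (s : cube X) i b : square s -> i < 2 -> edge (face s i b).
Proof.
move=> [sX s2] i2; split; first by apply: face_cubes; rewrite // s2.
by apply: succn_inj; rewrite dim_face ?s2.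
Qed.

Lemma edge_path_square (s : cube X) d e : square s ->
  edge_path X (origin (face s 1 e, d))
    [:: (face s 1 e, d); (face s 0 (~~ d), e)] (terminus (face s 0 (~~ d), e)).
Proof.
move=> sq; split=> //=; first exact: edge_square.
split=> //; first exact: edge_square.
by rewrite /origin /terminus /= (@face_face _ s 0 1) // sq.2.
Qed.

(* The square relation for all orientations of the two sides: d is the direction
   of travel along the coordinate 0, e along the coordinate 1. *)
Lemma homotopic_square_swap s d e : square s ->
  homotopic X (origin (face s 1 e, d)) (terminus (face s 0 (~~ d), e))
    [:: (face s 1 e, d); (face s 0 (~~ d), e)]
    [:: (face s 0 d, e); (face s 1 (~~ e), d)].
Proof.
move=> sq; have ed i b : i < 2 -> edge (face s i b) by exact: edge_square.
have corner d' e' : face (face s 1 e') 0 d' = face (face s 0 d') 0 e'.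
  by rewrite face_face // sq.2.
have path1 d' e' := edge_path_square d' e' sq.
have path2 d' e' : edge_path X (origin (face s 1 e', d'))
    [:: (face s 0 d', e'); (face s 1 (~~ e'), d')] (terminus (face s 0 (~~ d'), e')).
  rewrite /= /origin /terminus /= corner; split=> //; first exact: ed.
  by split=> //; exact: ed.
(* [flip] reverses the travel along coordinate 0, and [flip'] that along coordinate 1; both start
   from the generating relation [h00]. *)
have flip d' e' :
    homotopic X (origin (face s 1 e', d')) (terminus (face s 0 (~~ d'), e'))
      [:: (face s 1 e', d'); (face s 0 (~~ d'), e')]
      [:: (face s 0 d', e'); (face s 1 (~~ e'), d')] ->
    homotopic X (origin (face s 1 e', ~~ d')) (terminus (face s 0 d', e'))
      [:: (face s 1 e', ~~ d'); (face s 0 d', e')]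
      [:: (face s 0 (~~ d'), e'); (face s 1 (~~ e'), ~~ d')].
  exact: homotopic_rotate.
have flip' d' e' :
    homotopic X (origin (face s 1 e', d')) (terminus (face s 0 (~~ d'), e'))
      [:: (face s 1 e', d'); (face s 0 (~~ d'), e')]
      [:: (face s 0 d', e'); (face s 1 (~~ e'), d')] ->
    homotopic X (origin (face s 1 (~~ e'), d')) (terminus (face s 0 (~~ d'), ~~ e'))
      [:: (face s 1 (~~ e'), d'); (face s 0 (~~ d'), ~~ e')]
      [:: (face s 0 d', ~~ e'); (face s 1 e', d')].
  move=> /(rst_sym _ _ _ _) h; apply: rst_sym.
  have := homotopic_rotate (path2 d' e') (path1 d' e') h.
  by rewrite /reverse /terminus /origin /= !negbK !corner.
have h00 : homotopic X (origin (face s 1 false, false)) (terminus (face s 0 true, false))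
    [:: (face s 1 false, false); (face s 0 true, false)]
    [:: (face s 0 false, false); (face s 1 true, false)].
  apply: rst_step; split; [exact: (path1 false false)|exact: (path2 false false)|].
  exact: (@homotopy_square X [::] [::] s).
have h10 := flip false false h00.
case: d; case: e => //; [exact: (flip' true false)|exact: (flip' false false)].
Qed.

End Homotopy.

Lemma map_path_cat (X Y : cube_complex) (f : cube X -> cube Y) p q :
  map_path f (p ++ q) = map_path f p ++ map_path f q.
Proof. exact: map_cat. Qed.

Section HomotopyMap.
Variables (X Y : cube_complex) (f : cube X -> cube Y).
Hypothesis f_map : combinatorial_map f.

Lemma edge_map e : edge e -> edge (f e).
Proof. by move=> [eX e1]; have [? d _] := f_map eX; split=> //; rewrite d. Qed.

Lemma face_edge_map e b : edge e -> face (f e) 0 b = f (face e 0 b).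
Proof. by move=> [eX e1]; have [_ _ ->] := f_map eX; rewrite ?e1. Qed.

Lemma edge_path_map x p y : edge_path X x p y -> edge_path Y (f x) (map_path f p) (f y).
Proof.
elim: p x => [|o p ih] x /=; first by move->.
move=> [eo <- /ih h]; split; first exact: edge_map.
  by rewrite /origin /= face_edge_map.
by rewrite /terminus /= face_edge_map.
Qed.

Lemma homotopic_map x y p q :
  homotopic X x y p q -> homotopic Y (f x) (f y) (map_path f p) (map_path f q).
Proof.
elim=> [{}p {}q [hp hq pq]|r|r s _|r s t _ h1 _ h2]; last first.
- exact: rst_trans h1 h2.
- exact: rst_sym.
- exact: rst_refl.
apply: rst_step; split; [exact: edge_path_map|exact: edge_path_map|].
case: pq => [r s o eo|r s c [cX c2]]; rewrite !map_path_cat.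
  exact: (@homotopy_backtrack Y _ _ (f o.1, o.2) (edge_map eo)).
have [fX fd ff] := f_map cX; rewrite /= !ff ?c2 //.
by apply: homotopy_square; split=> //; rewrite fd.
Qed.

Lemma connected_map x y : connected_to X x y -> connected_to Y (f x) (f y).
Proof. by move=> [p hp]; exists (map_path f p); exact: edge_path_map. Qed.

End HomotopyMap.

Lemma subcomplex_map (X : cube_complex) (A : set (cube X)) (hA : closed_under_faces A) :
  combinatorial_map (X := subcomplex hA) (Y := X) id.
Proof. by move=> c cA; split=> //; exact: hA.1. Qed.

Lemma homotopic_subcomplex (X : cube_complex) (A : set (cube X))
    (hA : closed_under_faces A) x y p q :
  homotopic (subcomplex hA) x y p q -> homotopic X x y p q.
Proof.
move=> /(homotopic_map (@subcomplex_map X A hA)).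
have idE r : map_path (X := subcomplex hA) (Y := X) id r = r.
  by elim: r => //= -[? ?] r ->.
by rewrite !idE.
Qed.

Lemma edge_path_subcomplex (X : cube_complex) (A : set (cube X))
    (hA : closed_under_faces A) x y p :
  edge_path (subcomplex hA) x p y -> edge_path X x p y.
Proof.
by elim: p x => //= o p ih x [[eA e1] ox /ih hp]; split=> //; split=> //; exact: hA.1.
Qed.

(** * Paths in a product of two cube complexes *)

Section ProductPaths.
Variables X Y : cube_complex.
Local Notation Z := (product_complex X Y).

Lemma product_slice_left (y : cube Y) : vertex y ->
  combinatorial_map (X := X) (Y := Z) (fun c => (c, y)).
Proof.
move=> [yY y0] c cX; split=> //=; first by rewrite y0 addn0.
by move=> i e ic; rewrite ic.
Qed.

Lemma product_slice_right (x : cube X) : vertex x ->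
  combinatorial_map (X := Y) (Y := Z) (fun d => (x, d)).
Proof.
move=> [xX x0] d dY; split=> //=; first by rewrite x0.
by move=> i e id; rewrite x0 subn0.
Qed.

Definition left_path (p : seq (oriented_edge Z)) : seq (oriented_edge X) :=
  [seq (o.1.1, o.2) | o <- p & dim o.1.1 == 1].
Definition right_path (p : seq (oriented_edge Z)) : seq (oriented_edge Y) :=
  [seq (o.1.2, o.2) | o <- p & dim o.1.1 == 0].

Lemma vertex_terminus (X' : cube_complex) (c : cube X') b : edge c -> vertex (face c 0 b).
Proof.
move=> [cX c1]; split; first by apply: face_cubes; rewrite // c1.
by apply: succn_inj; rewrite dim_face ?c1.
Qed.

Lemma homotopic_slide x x' (y y' : cube Y) (p : seq (oriented_edge X)) d b :
  vertex x -> edge d -> face d 0 b = y -> face d 0 (~~ b) = y' ->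
  edge_path X x p x' ->
  homotopic Z (x, y) (x', y')
    (((x, d), b) :: map_path (Y := Z) (fun c => (c, y')) p)
    (map_path (Y := Z) (fun c => (c, y)) p ++ [:: ((x', d), b)]).
Proof.
move=> vx ed dy dy'; elim: p x vx => [|[c b'] p ih] x vx /=.
  by move=> ->; exact: rst_refl.
move=> [ec cx hp].
have vx1 : vertex (terminus (c, b')) by exact: vertex_terminus.
have sq : @square Z (c, d).
  by split=> /=; [split; [case: ec|case: ed]|rewrite ec.2 ed.2].
have := @homotopic_square_swap Z (c, d) b' b sq.
rewrite /origin /terminus /= ec.2 /= ec.2 /= (vertex_terminus (~~ b') ec).2 /= dy dy' => h.
have -> : (x, y) = (face c 0 b', y) by rewrite -cx.
have vy' : vertex y' by rewrite -dy'; exact: vertex_terminus.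
have vy : vertex y by rewrite -dy; exact: vertex_terminus.
have h1 := edge_path_map (product_slice_left vy') hp.
have := homotopic_catr h1 (homotopic_sym h).
rewrite -cx /origin /= => h2; apply: homotopic_trans h2 _.
have e1 : edge_path Z (face c 0 b', y) [:: ((c, y), b')] (terminus (c, b'), y).
  split=> //=; last by rewrite /terminus /= ec.2.
    by split=> /=; [split; [case: ec|case: vy]|rewrite ec.2 vy.2].
  by rewrite /origin /= ec.2.
exact: (homotopic_catl e1 (ih _ vx1 hp)).
Qed.

(** Sliding every edge of the second factor past the later edges of the first one sorts the path
    into its two projections. *)
Lemma product_path_split x y p z : vertex x -> vertex y -> edge_path Z (x, y) p z ->
  [/\ edge_path X x (left_path p) z.1, edge_path Y y (right_path p) z.2 &
    homotopic Z (x, y) z p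
      (map_path (Y := Z) (fun c => (c, y)) (left_path p) ++
       map_path (Y := Z) (fun d => (z.1, d)) (right_path p))].
Proof.
elim: p x y => [|[[c d] b] p ih] x y vx vy /=.
  by move=> <-; split=> //; exact: rst_refl.
move=> [[[/= cX dY] cd] oxy hp].
have [c1|c1] := eqVneq (dim c) 1.
  have d0 : dim d = 0 by move: cd; rewrite c1 => -[].
  have ec : edge c by [].
  move: oxy hp; rewrite /origin /terminus /= c1 /= => -[cx dy] hp.
  have v1 : vertex (face c 0 (~~ b)) by exact: vertex_terminus.
  rewrite dy in hp *; have [h1 h2 h3] := ih _ _ v1 vy hp.
  rewrite /left_path /right_path /= c1 /=; split=> //.
  have e1 : edge_path Z (x, y) [:: ((c, y), b)] (face c 0 (~~ b), y).
    split=> //=; last by rewrite /terminus /= c1.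
      by split=> /=; [split; [|case: vy]|rewrite c1 vy.2].
    by rewrite /origin /= c1 /= cx.
  exact: (homotopic_catl e1 h3).
have c0 : dim c = 0 by move: cd c1; case: (dim c) => [|[|n]].
have ed : edge d by split=> //; rewrite c0 in cd.
move: oxy hp; rewrite /origin /terminus /= c0 /= => -[cx dy] hp.
have v1 : vertex (face d 0 (~~ b)) by exact: vertex_terminus.
rewrite cx in hp *; have [h1 h2 h3] := ih _ _ vx v1 hp.
rewrite /left_path /right_path /= vx.2 /=; split=> //.
have e1 : edge_path Z (x, y) [:: ((x, d), b)] (x, face d 0 (~~ b)).
  split=> //=; last by rewrite /terminus /= vx.2.
    by split=> /=; [split; [case: vx|]|rewrite vx.2; case: ed].
  by rewrite /origin /= vx.2 /= dy.
apply: homotopic_trans (homotopic_catl e1 h3) _; rewrite catA.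
have hz : vertex z.1.
  elim: (left_path p) (x) vx h1 => [|o q ihq] x' vx' /= => [<- //|[eo _]].
  by apply: ihq; exact: vertex_terminus.
have e2 := edge_path_map (product_slice_right hz) h2.
rewrite -surjective_pairing in e2.
have := homotopic_catr e2 (homotopic_slide vx ed dy erefl h1).
by rewrite -catA.
Qed.

Lemma homotopic_right_path x y p : vertex x -> vertex y -> trivial_pi1 X x ->
  edge_path Z (x, y) p (x, y) ->
  homotopic Z (x, y) (x, y) p (map_path (Y := Z) (fun d => (x, d)) (right_path p)).
Proof.
move=> vx vy Dx hp; have [h1 h2 h3] := product_path_split vx vy hp.
apply: homotopic_trans h3 _.
have := homotopic_map (product_slice_left vy) (Dx _ h1).
have e2 := edge_path_map (product_slice_right vx) h2.
exact: (homotopic_catr e2).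
Qed.

End ProductPaths.

(** * Squier complexes *)

Section SquierPaths.
Variables (Sigma : choiceType) (P : presentation Sigma).
Local Notation word := (seq Sigma).
Local Notation S := (squier P).
Implicit Types (a b c u v : word) (r : word * word) (o : oriented_edge S).

Definition side r (e : bool) : word := if e then r.2 else r.1.

Lemma vertex_cube_cat a b : vertex_cube (a ++ b) = vertex_cube a ++ vertex_cube b.
Proof. exact: map_cat. Qed.

Lemma vertex_cube_inj : injective (@vertex_cube Sigma).
Proof. by apply: inj_map => x y []. Qed.

Lemma squier_dim0 (x : squier_cube Sigma) :
  squier_dim x = 0 -> exists a, x = vertex_cube a.
Proof.
elim: x => [|[l|r] x ih] //= x0; first by exists [::].
by have [a ->] := ih x0; exists (l :: a).
Qed.

Lemma squier_dimS (x : squier_cube Sigma) n : squier_dim x = n.+1 ->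
  exists a r x', x = vertex_cube a ++ inr r :: x' /\ squier_dim x' = n.
Proof.
elim: x => [|[l|r] x ih] //= xn.
  by have [a [r [x' [-> x'n]]]] := ih xn; exists (l :: a), r, x'.
by exists [::], r, x; split=> //; case: xn.
Qed.

Lemma squier_cubes_cons r (x : squier_cube Sigma) :
  squier_cubes P (inr r :: x) <-> relations P r /\ squier_cubes P x.
Proof.
split=> [h|[rP xP] s]; last by rewrite inE => /orP[/eqP[->]|/xP].
by split=> [|s sx]; apply: h; rewrite inE ?eqxx ?sx ?orbT.
Qed.

Lemma squier_edgeP (e : cube S) :
  edge e <-> exists a r b, e = edge_cube a r b /\ relations P r.
Proof.
split=> [[eP e1]|[a [r [b [-> rP]]]]].
  have [a [r [x [eE /squier_dim0[b xE]]]]] := squier_dimS e1.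
  exists a, r, b; split; first by rewrite eE xE.
  by move: eP; rewrite eE => /squier_cubes_cat[_ /squier_cubes_cons[]].
split; last by rewrite /= squier_dim_cat /= !squier_dim_vertex.
apply/squier_cubes_cat; split; first exact: squier_cubes_vertex.
by apply/squier_cubes_cons; split=> //; exact: squier_cubes_vertex.
Qed.

Lemma edge_cube_edge a r b : relations P r -> @edge S (edge_cube a r b).
Proof. by move=> rP; apply/squier_edgeP; exists a, r, b. Qed.

Lemma squier_face0 a r (x : squier_cube Sigma) e :
  squier_face (vertex_cube a ++ inr r :: x) 0 e =
  vertex_cube a ++ vertex_cube (side r e) ++ x.
Proof. by rewrite squier_face_cat squier_dim_vertex. Qed.

Lemma squier_faceS a r (x : squier_cube Sigma) i e :
  squier_face (vertex_cube a ++ inr r :: x) i.+1 e =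
  vertex_cube a ++ inr r :: squier_face x i e.
Proof. by rewrite squier_face_cat squier_dim_vertex. Qed.

Lemma face_edge_cube a r b e :
  squier_face (edge_cube a r b) 0 e = vertex_cube (a ++ side r e ++ b).
Proof. by rewrite squier_face0 !vertex_cube_cat. Qed.

(** Meant for edges, where it reads off the position and the relation symbol; without such a symbol
    the value is a dummy. *)
Fixpoint first_relation (x : squier_cube Sigma) : nat * (word * word) :=
  match x with
  | [::] => (0, ([::], [::]))
  | inl _ :: x' => ((first_relation x').1.+1, (first_relation x').2)
  | inr r :: _ => (0, r)
  end.

Lemma first_relationE a r x : first_relation (vertex_cube a ++ inr r :: x) = (size a, r).
Proof. by elim: a => //= l a ->. Qed.

Definition step_of o : step Sigma :=
  ((first_relation o.1).1,
   (side (first_relation o.1).2 o.2, side (first_relation o.1).2 (~~ o.2))).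

Lemma step_ofE a r x e :
  step_of (vertex_cube a ++ inr r :: x, e) = (size a, (side r e, side r (~~ e))).
Proof. by rewrite /step_of first_relationE. Qed.

Lemma step_of_reverse o : step_of (reverse o) = step_rev (step_of o).
Proof. by rewrite /step_of /= negbK. Qed.

Lemma proper_step_of o : edge o.1 -> proper_step (step_of o).
Proof.
case: o => e d /= /squier_edgeP[a [r [b [-> rP]]]]; rewrite step_ofE /proper_step /=.
have [] := @relations_neq1 _ P r.1 r.2; first by case: (r) rP.
by case: r {rP} => -[|? ?] [|? ?] // _ _; case: d.
Qed.

Lemma all_proper_step_of x p y : edge_path S x p y ->
  all (@proper_step Sigma) (map step_of p).
Proof.
by elim: p x => //= o p ih x [eo _ /ih->]; rewrite proper_step_of.
Qed.

(** Position and words locate the rewriting inside the common origin, and asymmetry of [relations]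
    excludes two edges that realize it with opposite orientations. *)
Lemma step_of_inj o o' : edge o.1 -> edge o'.1 -> origin o = origin o' ->
  step_of o = step_of o' -> o = o'.
Proof.
case: o o' => [e d] [e' d'] /= /squier_edgeP[a [r [b [-> rP]]]].
move=> /squier_edgeP[a' [r' [b' [-> r'P]]]]; rewrite /origin /=.
rewrite !face_edge_cube !step_ofE => /vertex_cube_inj ww [sz s1 s2].
move/eqP: ww; rewrite eqseq_cat // s1 eqseq_cat // => /and3P[/eqP-> _ /eqP->].
have [dd|dd] := eqVneq d d'.
  rewrite -dd in s1 s2 *; congr (edge_cube _ _ _, _).
  by case: r r' d {rP r'P sz dd} s1 s2 => [u v] [u' v'] [] /= -> ->.
case: (@relations_asym _ P r.1 r.2); first by case: (r) rP.
suff -> : (r.2, r.1) = r' by [].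
by case: r r' d d' dd s1 s2 {rP r'P sz} => [u v] [u' v'] [] [] //= _ -> ->.
Qed.

Lemma edge_path_steps_inj x p q y z : edge_path S x p y -> edge_path S x q z ->
  map step_of p = map step_of q -> p = q.
Proof.
elim: p x q => [|o p ih] x [|o' q] //= [eo ox hp] [eo' ox' hq] so.
have oE : o = o'.
  apply: step_of_inj => //; first exact: (etrans ox (esym ox')).
  by rewrite -[LHS]/(head (step_of o) (step_of o :: map step_of p)) so.
have {so} sq : map step_of p = map step_of q := congr1 behead so.
by rewrite -oE in hq *; congr cons; exact: ih hp hq sq.
Qed.


(** The factors rewritten by [o] and [x] are disjoint, so both rewritings are sides of one square,
    and its other two sides perform them in the opposite order. *)
Lemma left_of_square o x : edge o.1 -> edge x.1 -> terminus o = origin x ->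
  left_of (step_of x) (step_of o) ->
  exists s : cube S, [/\ square s, o = (face s 0 x.2, o.2),
    x = (face s 1 (~~ o.2), x.2),
    step_of (face s 1 o.2, x.2) = step_of x &
    step_of (face s 0 (~~ x.2), o.2) = step_after (step_of x) (step_of o)].
Proof.
case: o x => [e1 e] [e2 d] /= /squier_edgeP[a [r [b [-> rP]]]].
move=> /squier_edgeP[a2 [r2 [b2 [-> r2P]]]]; rewrite /origin /terminus /=.
rewrite !face_edge_cube !step_ofE /left_of /= => /vertex_cube_inj ww sz.
(* [c] is the part of the word lying between the two rewritten factors. *)
have [c [aE bE]] : exists c, a = a2 ++ side r2 d ++ c /\ b2 = c ++ side r (~~ e) ++ b.
  exists (drop (size a2 + size (side r2 d)) a).
  have h : take (size a2 + size (side r2 d)) a = a2 ++ side r2 d.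
    have := congr1 (take (size a2 + size (side r2 d))) ww.
    rewrite takel_cat // catA take_cat size_cat ltnn subnn take0 cats0.
    by [].
  rewrite catA -h cat_take_drop; split=> //.
  have <- : drop (size a2 + size (side r2 d)) (a2 ++ side r2 d ++ b2) = b2.
    by rewrite catA drop_size_cat ?size_cat.
  rewrite -ww drop_cat; case: ltngtP sz => // -> _.
  by rewrite subnn drop0 drop_size.
pose s : squier_cube Sigma :=
  vertex_cube a2 ++ inr r2 :: vertex_cube c ++ inr r :: vertex_cube b.
have s0 (b' : bool) : squier_face s 0 b' = edge_cube (a2 ++ side r2 b' ++ c) r b.
  by rewrite /s squier_face0 /edge_cube !vertex_cube_cat -!catA.
have s1 (b' : bool) : squier_face s 1 b' = edge_cube a2 r2 (c ++ side r b' ++ b).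
  by rewrite /s squier_faceS squier_face0 /edge_cube !vertex_cube_cat.
exists s; rewrite !s0 !s1 !step_ofE -?aE -?bE; split=> //.
  split; last by rewrite /= /s squier_dim_cat /= squier_dim_cat /= !squier_dim_vertex.
  apply/squier_cubes_cat; split; first exact: squier_cubes_vertex.
  apply/squier_cubes_cons; split=> //.
  by have [] := edge_cube_edge c b rP.
rewrite /step_after /= aE !size_cat; congr (_, _).
by lia.
Qed.

(** The combinatorial insertion is realized by homotopies: a cancellation is a backtrack, a move to
    the right crosses a square. *)
Lemma insert_step_path o p y : edge o.1 -> edge_path S (terminus o) p y ->
  exists p', homotopic S (origin o) y (o :: p) p' /\
    map step_of p' = insert_step (step_of o) (map step_of p).
Proof.
elim: p o => [|x p ih] o eo /=.
  by move=> yE; exists [:: o]; split=> //; exact: rst_refl.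
move=> [ex xo hp]; case: eqP => [E|_].
  have xE : x = reverse o.
    by apply: step_of_inj => //; rewrite step_of_reverse.
  have {}hp : edge_path S (origin o) p y by rewrite -terminus_reverse -xE.
  by exists p; split=> //; rewrite xE; exact: (homotopic_catr hp (homotopic_backtrack eo)).
case: ifP => [xl|_]; last by exists (o :: x :: p); split=> //; exact: rst_refl.
have [s [sq oE xE sx so]] := left_of_square eo ex (esym xo) xl.
have sw := homotopic_square_swap x.2 o.2 sq.
set x' := (face s 1 o.2, x.2) in sx sw; set o' := (face s 0 (~~ x.2), o.2) in so sw.
rewrite -oE -xE in sw.
have px : edge_path S (origin x') [:: x'; o'] (terminus o') by exact: edge_path_square.
have [_ oox [_ _ xt]] := (homotopic_edge_path sw).1 px.
have [ex' _ [eo' o'x _]] := px.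
have hp' : edge_path S (terminus o') p y by rewrite -xt.
have [p' [h' sp']] := ih _ eo' hp'.
exists (x' :: p'); split; last by rewrite /= sx -so sp'.
have -> : squier_face o.1 0 o.2 = origin x' := oox.
apply: homotopic_trans (homotopic_catr hp' (homotopic_sym sw)) _.
by apply: (@homotopic_catl _ _ (terminus x') _ [:: x']) => //; rewrite -o'x.
Qed.

Lemma reduce_path x p y : edge_path S x p y -> exists p',
  homotopic S x y p p' /\ map step_of p' = reduce (map step_of p).
Proof.
elim: p x => [|o p ih] x /=.
  by move=> xy; exists [::]; split=> //; exact: rst_refl.
move=> [eo ox hp]; have [p1 [h1 s1]] := ih _ hp.
have hp1 := (homotopic_edge_path h1).1 hp.
have [p2 [h2 s2]] := insert_step_path eo hp1.
exists p2; rewrite s2 s1; split=> //; rewrite -ox.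
apply: homotopic_trans h2.
exact: (@homotopic_catl _ _ (terminus o) _ [:: o]).
Qed.

(** The generators of homotopy correspond to [reduce_backtrack] and [reduce_swap]; in a square, the
    relation symbol written first plays the part of the left step. *)
Lemma reduce_homotopic x y p q : homotopic S x y p q ->
  reduce (map step_of p) = reduce (map step_of q).
Proof.
elim=> // [{}p {}q [hp hq pq]|? ? ? _ -> //].
case: pq hp hq => [r s o eo|r s c [cP c2]] hp hq; rewrite !map_cat.
  have [z [_ hs]] := edge_path_catP hq.
  by rewrite /= step_of_reverse reduce_backtrack ?proper_step_of // (all_proper_step_of hs).
have [z [_ /= [_ _ [_ _ hs]]]] := edge_path_catP hp.
have [a [r1 [c' [cE c1]]]] := squier_dimS c2.
have [b [r2 [c'' [xE _]]]] := squier_dimS c1.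
have s0 (e d : bool) : step_of (face c 0 e, d) =
    (size a + size (side r1 e) + size b, (side r2 d, side r2 (~~ d))).
  by rewrite /= cE xE squier_face0 !catA -!vertex_cube_cat step_ofE !size_cat.
have s1 (e d : bool) : step_of (face c 1 e, d) = (size a, (side r1 d, side r1 (~~ d))).
  by rewrite /= cE xE squier_faceS step_ofE.
have [e0 e1] := (@edge_square S c 0 false (conj cP c2) isT, @edge_square S c 1 true (conj cP c2) isT).
have := @reduce_swap _ (map step_of r) (map step_of s) (step_of (face c 1 true, false))
  (step_of (face c 0 false, false)).
rewrite !proper_step_of // => /(_ isT isT (all_proper_step_of hs)).
rewrite /= !s0 !s1 /left_of /= leq_addr => /(_ isT) ->.
congr (reduce (_ ++ [:: _, _ & _])); rewrite /step_after /=; congr (_, _).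
by lia.
Qed.

(** For the converse, both paths are homotopic to paths with equal steps, and the origin together
    with the steps determines a path. *)
Lemma homotopic_reduceP x y p q : edge_path S x p y -> edge_path S x q y ->
  homotopic S x y p q <-> reduce (map step_of p) = reduce (map step_of q).
Proof.
move=> hp hq; split; first exact: reduce_homotopic.
have [p' [hpp' sp']] := reduce_path hp; have [q' [hqq' sq']] := reduce_path hq.
rewrite -sp' -sq' => /(edge_path_steps_inj ((homotopic_edge_path hpp').1 hp)
  ((homotopic_edge_path hqq').1 hq)) E.
by apply: homotopic_trans hpp' _; rewrite E; exact: homotopic_sym.
Qed.

End SquierPaths.

(** * Translations, components of Squier complexes, and splitting of cubes *)

Section SquierComponents.
Variables (Sigma : choiceType) (P : presentation Sigma).
Local Notation word := (seq Sigma).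
Local Notation S := (squier P).
Implicit Types (a b c u v : word) (r : word * word) (o : oriented_edge S).
Implicit Types (x y : squier_cube Sigma).

Definition extend_cube a b x : squier_cube Sigma := vertex_cube a ++ x ++ vertex_cube b.

Lemma extend_cube_map a b : @combinatorial_map S S (extend_cube a b).
Proof.
move=> x xP; rewrite /extend_cube; split.
- apply/squier_cubes_cat; split; first exact: squier_cubes_vertex.
  by apply/squier_cubes_cat; split=> //; exact: squier_cubes_vertex.
- by rewrite /= !squier_dim_cat !squier_dim_vertex addn0.
- by move=> i e ix; rewrite /= !squier_face_cat squier_dim_vertex ltn0 subn0 ix.
Qed.

Lemma steps_extend a b x p y : edge_path S x p y ->
  map (@step_of _ P) (map_path (X := S) (Y := S) (extend_cube a b) p) =
  map (step_shift (size a)) (map (@step_of _ P) p).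
Proof.
elim: p x => //= -[e d] p ih x /= [/squier_edgeP[c [r [c' [-> _]]]] _ /ih ->].
congr cons; rewrite /extend_cube /edge_cube.
have -> : vertex_cube a ++ (vertex_cube c ++ inr r :: vertex_cube c') ++ vertex_cube b =
    vertex_cube (a ++ c) ++ inr r :: vertex_cube c' ++ vertex_cube b.
  by rewrite vertex_cube_cat -!catA.
by rewrite !step_ofE size_cat.
Qed.

(** Translation shifts all steps by [size a]; this commutes with [reduce] and is injective, so equal
    normal forms upstairs give equal ones downstairs. *)
Lemma homotopic_extend a b x y p q : edge_path S x p y -> edge_path S x q y ->
  homotopic S (extend_cube a b x) (extend_cube a b y)
    (map_path (X := S) (Y := S) (extend_cube a b) p)
    (map_path (X := S) (Y := S) (extend_cube a b) q) ->
  homotopic S x y p q.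
Proof.
move=> hp hq /reduce_homotopic; rewrite !(steps_extend a b hp, steps_extend a b hq).
rewrite !reduce_shift => /(inj_map (@step_shift_inj _ _)) h.
exact/homotopic_reduceP.
Qed.

Definition word_connected a b := connected_to S (vertex_cube a) (vertex_cube b).

Lemma word_connected_refl a : word_connected a a.
Proof. by exists [::]. Qed.

Lemma word_connected_sym a b : word_connected a b -> word_connected b a.
Proof. exact: connected_sym. Qed.

Lemma word_connected_trans a b c :
  word_connected a b -> word_connected b c -> word_connected a c.
Proof. exact: connected_cat. Qed.

Lemma word_connected_cat a a' b b' : word_connected a a' -> word_connected b b' ->
  word_connected (a ++ b) (a' ++ b').
Proof.
move=> aa bb; apply: (@word_connected_trans _ (a' ++ b)).
  have := connected_map (extend_cube_map [::] b) aa.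
  by rewrite /extend_cube /= -!vertex_cube_cat.
have := connected_map (extend_cube_map a' [::]) bb.
by rewrite /extend_cube /= !cats0 -!vertex_cube_cat.
Qed.

Lemma word_connected_relation r : relations P r -> word_connected r.1 r.2.
Proof.
move=> rP; exists [:: (edge_cube [::] r [::], false)].
split; first exact: edge_cube_edge.
- by rewrite /origin /= !cats0.
- by rewrite /terminus /= !cats0.
Qed.

(** The corner of the cube at which every u_i is chosen; it represents all corners when components
    are compared. *)
Fixpoint base_word x : word :=
  match x with
  | [::] => [::]
  | inl l :: x' => l :: base_word x'
  | inr r :: x' => r.1 ++ base_word x'
  end.

Lemma base_word_cat x y : base_word (x ++ y) = base_word x ++ base_word y.
Proof. by elim: x => [|[l|r] x ih] //=; rewrite ih ?catA. Qed.

Lemma base_word_vertex a : base_word (vertex_cube a) = a.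
Proof. by elim: a => //= l a ->. Qed.

Lemma base_word_face x i e : squier_cubes P x -> i < squier_dim x ->
  word_connected (base_word x) (base_word (squier_face x i e)).
Proof.
elim: x i => [|[l|r] x ih] i //=.
  move=> xP ix; apply: (@word_connected_cat [:: l] [:: l]); first exact: word_connected_refl.
  by apply: ih => // s sx; apply: xP; rewrite inE sx orbT.
move=> /squier_cubes_cons[rP xP]; case: i => [_|i ix] /=.
  rewrite base_word_cat base_word_vertex; apply: word_connected_cat.
    by case: (e); [exact: word_connected_relation|exact: word_connected_refl].
  exact: word_connected_refl.
by apply: word_connected_cat; [exact: word_connected_refl|exact: ih].
Qed.

Lemma base_word_iterated_face x y : squier_cubes P x -> iterated_face (X := S) x y ->
  squier_cubes P y /\ word_connected (base_word x) (base_word y).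
Proof.
move=> xP; elim=> [|z i e _ [zP xz] iz]; first by split=> //; exact: word_connected_refl.
split; first exact: squier_face_cubes.
exact: word_connected_trans xz (base_word_face e zP iz).
Qed.

Lemma iterated_face_base x : iterated_face (X := S) x (vertex_cube (base_word x)).
Proof.
elim: {x}(squier_dim x) {-2}x (erefl (squier_dim x)) => [|n ih] x xn.
  have [a ->] := squier_dim0 xn; rewrite base_word_vertex; exact: iterated_face_refl.
have h : 0 < squier_dim x by rewrite xn.
have [a [r [x' [xE _]]]] := squier_dimS xn.
apply: (@iterated_face_trans S x 0 false) => //.
have -> : base_word x = base_word (squier_face x 0 false).
  by rewrite xE squier_face0 !base_word_cat /= base_word_vertex base_word_vertex.
by apply: ih; apply: succn_inj; rewrite squier_dim_face.
Qed.

(** All corners of a cube are connected to each other, so it suffices to test one. *)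
Lemma component_squierP a x : component_cubes (X := S) (vertex_cube a) x <->
  squier_cubes P x /\ word_connected a (base_word x).
Proof.
split=> [[xP h]|[xP ax]]; split=> //.
  by apply: h; [exact: iterated_face_base|exact: squier_dim_vertex].
move=> y xy y0; have [_ xy'] := base_word_iterated_face xP xy.
have [b yE] := squier_dim0 y0; rewrite yE base_word_vertex in xy' *.
exact: word_connected_trans ax xy'.
Qed.

Lemma edge_component a e d : @edge S e ->
  connected_to S (vertex_cube a) (squier_face e 0 d) ->
  @edge (squier_component P a) e.
Proof.
move=> [eP e1] h; split=> //; apply/component_squierP; split=> //.
have := base_word_face d eP; rewrite [squier_dim e]e1 => /(_ 0 isT).
have : squier_dim (squier_face e 0 d) = 0.
  by apply: succn_inj; rewrite squier_dim_face // [squier_dim e]e1.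
move=> /squier_dim0[b bE]; rewrite bE base_word_vertex in h *.
by move/word_connected_sym; exact: word_connected_trans.
Qed.

Lemma edge_path_component a x p y : connected_to S (vertex_cube a) x ->
  edge_path S x p y -> edge_path (squier_component P a) x p y.
Proof.
elim: p x => //= o p ih x ax [eo ox hp]; split=> //.
  by apply: (@edge_component _ _ o.2) => //; move: ox => /= ->.
apply: ih => //; apply: connected_cat ax _; exists [:: o].
by split.
Qed.

(** A path starting in a component stays there, and a square with one edge in the component lies in
    it; hence homotopies never leave it. *)
Lemma homotopic_component a x y p q : connected_to S (vertex_cube a) x ->
  homotopic S x y p q -> homotopic (squier_component P a) x y p q.
Proof.
move=> ax; elim=> [{}p {}q [hp hq pq]|r|r s _|r s t _ h1 _ h2]; last first.
- exact: rst_trans h1 h2.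
- exact: rst_sym.
- exact: rst_refl.
have {}hp := edge_path_component ax hp; have {}hq := edge_path_component ax hq.
apply: rst_step; split=> //; case: pq hp hq => [r s o eo|r s c [cP c2]] hp hq.
  have [z [_ [eo' _ _]]] := edge_path_catP hp.
  exact: (@homotopy_backtrack (squier_component P a)).
have [z [_ [[/component_squierP[_ ae] _] _ _]]] := edge_path_catP hp.
apply: (@homotopy_square (squier_component P a)); split=> //.
apply/component_squierP; split=> //; apply: word_connected_trans ae _.
by apply/word_connected_sym/base_word_face; rewrite // [squier_dim c]c2.
Qed.

Lemma trivial_diagram_groupP a :
  trivial_diagram_group P a <-> trivial_pi1 S (vertex_cube a).
Proof.
have aa : connected_to S (vertex_cube a) (vertex_cube a) by exists [::].
split=> Da p hp.
  by have := Da _ (edge_path_component aa hp); exact: homotopic_subcomplex.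
apply: homotopic_component => //; apply: Da; exact: edge_path_subcomplex hp.
Qed.

Lemma trivial_diagram_group_connected a b : word_connected a b ->
  trivial_diagram_group P a -> trivial_diagram_group P b.
Proof.
by move=> [p ab] /trivial_diagram_groupP Da; apply/trivial_diagram_groupP/(trivial_pi1_move ab).
Qed.

(** A loop at [a] becomes contractible after right translation by [b], and translations reflect
    homotopy. *)
Lemma trivial_diagram_group_cat a b :
  trivial_diagram_group P (a ++ b) -> trivial_diagram_group P a.
Proof.
move=> /trivial_diagram_groupP Dab; apply/trivial_diagram_groupP => p hp.
apply: (@homotopic_extend [::] b) => //=.
have := edge_path_map (extend_cube_map [::] b) hp.
by rewrite /extend_cube /= -vertex_cube_cat; exact: Dab.
Qed.

Lemma trivial_diagram_group_nil : trivial_diagram_group P [::].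
Proof.
apply/trivial_diagram_groupP => -[|[e d] p] /= h; first exact: rst_refl.
case: h => /squier_edgeP[a [r [b [-> rP]]]] + _; rewrite /origin /= face_edge_cube.
have [] := @relations_neq1 _ P r.1 r.2; first by case: (r) rP.
by case: a; case: r {rP} => -[|? ?] [|? ?] //; case: d.
Qed.

Lemma cube_splitting x y : trivial_diagram_group P (base_word x) ->
  ~ trivial_diagram_group P (base_word (x ++ y)) ->
  exists y1 s y2, [/\ y = y1 ++ s :: y2, trivial_diagram_group P (base_word (x ++ y1)) &
    ~ trivial_diagram_group P (base_word (rcons (x ++ y1) s))].
Proof.
elim: y x => [|s y ih] x Dx; first by rewrite cats0.
have [Dxs|Dxs] := pselect (trivial_diagram_group P (base_word (rcons x s))).
  rewrite -cat_rcons => /(ih _ Dxs)[y1 [s' [y2 [-> h1 h2]]]].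
  by exists (s :: y1), s', y2; rewrite -!cat_rcons.
by exists [::], s, y; rewrite cats0.
Qed.

(** If the two splittings had different places, the shorter prefix with its next symbol would be a
    prefix of the longer one, hence have trivial diagram group. *)
Lemma cube_splitting_uniq x s y x' s' y' : x ++ s :: y = x' ++ s' :: y' ->
  trivial_diagram_group P (base_word x) ->
  ~ trivial_diagram_group P (base_word (rcons x s)) ->
  trivial_diagram_group P (base_word x') ->
  ~ trivial_diagram_group P (base_word (rcons x' s')) ->
  [/\ x = x', s = s' & y = y'].
Proof.
wlog xx' : x s y x' s' y' / size x <= size x'.
  move=> wl; have [|/ltnW] := leqP (size x) (size x'); first exact: wl.
  by move=> h E h1 h2 h3 h4; have [-> -> ->] := wl _ _ _ _ _ _ h (esym E) h3 h4 h1 h2.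
move: xx'; rewrite leq_eqVlt => /orP[/eqP xx' /eqP|xx' E _ nDxs Dx'].
  by rewrite eqseq_cat // => /andP[/eqP-> /eqP[-> ->]].
case: nDxs; have := congr1 (take (size x).+1) E.
rewrite -cat_rcons take_size_cat ?size_rcons // takel_cat // => ->.
by apply: (@trivial_diagram_group_cat _ (base_word (drop (size x).+1 x')));
  rewrite -base_word_cat cat_take_drop.
Qed.

End SquierComponents.

(** * Left hyperplanes *)

Section LeftHyperplanes.
Variables (Sigma : choiceType) (P : presentation Sigma) (w : seq Sigma).
Local Notation word := (seq Sigma).
Local Notation S := (squier P).
Local Notation T := (trivial_diagram_group P).
Local Notation "a ~ b" := (word_connected P a b) (at level 70).
Implicit Types (a b c u v : word) (r : word * word) (l : Sigma).
Implicit Types (x y : squier_cube Sigma).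

Lemma word_splitting_uniq a l b a' l' b' : a ++ l :: b = a' ++ l' :: b' ->
  T a -> ~ T (rcons a l) -> T a' -> ~ T (rcons a' l') -> [/\ a = a', l = l' & b = b'].
Proof.
move=> /(congr1 (@vertex_cube _)); rewrite !vertex_cube_cat /= => E h1 h2 h3 h4.
have := cube_splitting_uniq (P := P) E; rewrite !base_word_vertex -!(map_rcons inl).
rewrite -!/(vertex_cube _) !base_word_vertex => /(_ h1 h2 h3 h4).
by case=> /vertex_cube_inj-> [->] /vertex_cube_inj->.
Qed.

Lemma joined_cubesP a u b x : joined_cubes P a u b x <->
  exists x1 x2, [/\ x = x1 ++ vertex_cube u ++ x2,
    component_cubes (X := S) (vertex_cube a) x1 &
    component_cubes (X := S) (vertex_cube b) x2].
Proof.
split=> [[[x1 x2] [/= h1 h2] <-]|[x1 [x2 [-> h1 h2]]]]; first by exists x1, x2.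
by exists (x1, x2).
Qed.

Lemma joined_cubes_connected a a' u b b' : a ~ a' -> b ~ b' ->
  joined_cubes P a u b = joined_cubes P a' u b'.
Proof.
move=> aa bb; rewrite predeqE => x.
split=> /joined_cubesP[x1 [x2 [-> h1 h2]]]; apply/joined_cubesP; exists x1, x2; split=> //.
- by rewrite -(component_cubes_eq aa).
- by rewrite -(component_cubes_eq bb).
- by rewrite (component_cubes_eq aa).
- by rewrite (component_cubes_eq bb).
Qed.

Lemma joined_cubes_component a u b : w ~ a ++ u ++ b ->
  joined_cubes P a u b `<=` component_cubes (X := S) (vertex_cube w).
Proof.
move=> ww x /joined_cubesP[x1 [x2 [-> /component_squierP[xP1 ax] /component_squierP[xP2 bx]]]].
apply/component_squierP; split.
  apply/squier_cubes_cat; split=> //; apply/squier_cubes_cat; split=> //.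
  exact: squier_cubes_vertex.
rewrite !base_word_cat base_word_vertex; apply: word_connected_trans ww _.
apply: word_connected_cat => //; apply: word_connected_cat => //.
exact: word_connected_refl.
Qed.

Lemma edge_cube_component a r b : relations P r -> w ~ a ++ r.1 ++ b ->
  @edge (squier_component P w) (edge_cube a r b).
Proof.
move=> rP ww; apply: (@edge_component _ _ _ _ false); first exact: edge_cube_edge.
by rewrite face_edge_cube.
Qed.

Lemma component_edge_cube a r b : @edge (squier_component P w) (edge_cube a r b) ->
  relations P r /\ w ~ a ++ r.1 ++ b.
Proof.
move=> [/component_squierP[/squier_cubes_cat[_ /squier_cubes_cons[rP _]] h] _].
by split=> //; move: h; rewrite base_word_cat /= !base_word_vertex.
Qed.

Local Notation same_hyperplane :=
  (clos_refl_sym_trans (cube (squier_component P w)) (@parallel (squier_component P w))).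

Lemma parallel_contexts (e f : squier_cube Sigma) :
  @parallel (squier_component P w) e f -> exists a r b a' b',
  [/\ e = edge_cube a r b, f = edge_cube a' r b', a ~ a' & b ~ b'].
Proof.
move=> [s [i [[/component_squierP[sP _] s2] i2 -> ->]]].
have [a [r1 [x1 [sE x11]]]] := squier_dimS s2.
have [b [r2 [x2 [xE /squier_dim0[c cE]]]]] := squier_dimS x11.
have [r1P r2P] : relations P r1 /\ relations P r2.
  by split; apply: sP; rewrite sE xE mem_cat inE ?mem_cat ?inE ?eqxx ?orbT.
case: i i2 => [|[|//]] _.
  exists (a ++ r1.1 ++ b), r2, c, (a ++ r1.2 ++ b), c; split.
  - by rewrite /= sE xE cE squier_face0 /edge_cube !vertex_cube_cat -!catA.
  - by rewrite /= sE xE cE squier_face0 /edge_cube !vertex_cube_cat -!catA.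
  - apply: word_connected_cat; first exact: word_connected_refl.
    by apply: word_connected_cat; [exact: word_connected_relation|exact: word_connected_refl].
  - exact: word_connected_refl.
exists a, r1, (b ++ r2.1 ++ c), a, (b ++ r2.2 ++ c); split.
- by rewrite /= sE xE cE squier_faceS squier_face0 /edge_cube !vertex_cube_cat.
- by rewrite /= sE xE cE squier_faceS squier_face0 /edge_cube !vertex_cube_cat.
- exact: word_connected_refl.
- apply: word_connected_cat; first exact: word_connected_refl.
  by apply: word_connected_cat; [exact: word_connected_relation|exact: word_connected_refl].
Qed.

Lemma edge_cube_inj a r b a' r' b' : edge_cube a r b = edge_cube a' r' b' ->
  [/\ a = a', r = r' & b = b'].
Proof.
rewrite /edge_cube; elim: a a' => [|l a ih] [|l' a'] //=.
  by move=> [-> /vertex_cube_inj->].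
by move=> [-> /ih[-> -> ->]].
Qed.

Lemma same_hyperplane_contexts a r b (f : squier_cube Sigma) :
  same_hyperplane (edge_cube a r b) f ->
  exists a' b', [/\ f = edge_cube a' r b', a ~ a' & b ~ b'].
Proof.
(* An equivalence rather than an implication, so that it passes through the symmetric closure. *)
suff h e f' : same_hyperplane e f' ->
    (exists a' b', [/\ e = edge_cube a' r b', a ~ a' & b ~ b']) <->
    (exists a' b', [/\ f' = edge_cube a' r b', a ~ a' & b ~ b']).
  move=> /h[+ _]; apply; exists a, b; split=> //; exact: word_connected_refl.
elim=> [{}e g /parallel_contexts[a1 [r1 [b1 [a2 [b2 [-> -> aa bb]]]]]]|//|? ? _ ->|? ? ? _ -> _ ->] //.
split=> -[a' [b' [/edge_cube_inj[aE -> bE] h1 h2]]]; rewrite -aE in h1; rewrite -bE in h2.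
  exists a2, b2; split=> //.
    exact: word_connected_trans h1 aa.
  exact: word_connected_trans h2 bb.
exists a1, b1; split=> //.
  exact: word_connected_trans h1 (word_connected_sym aa).
exact: word_connected_trans h2 (word_connected_sym bb).
Qed.

(** With [same_hyperplane_contexts] this determines the edges of a hyperplane: a rewriting of a
    context and the relation [r] are independent, so they span a square in which the two copies of
    [r] are opposite sides. *)
Lemma same_hyperplane_connected a r b a' b' : relations P r -> w ~ a ++ r.1 ++ b ->
  a ~ a' -> b ~ b' -> same_hyperplane (edge_cube a r b) (edge_cube a' r b').
Proof.
move=> rP + [p]; elim: p a => /= [|[e d] p ih] a ww.
  (* The left context has arrived; the same induction is run on the right one. *)
  move=> /vertex_cube_inj <- [p]; elim: p b ww => /= [|[e d] p ih] b ww.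
    by move=> /vertex_cube_inj <- ; exact: rst_refl.
  case=> /= /squier_edgeP[c [r' [c' [eE r'P]]]] + hp; rewrite /origin /=.
  rewrite eE face_edge_cube => /vertex_cube_inj bE.
  rewrite /terminus /= eE face_edge_cube in hp.
  have cc : b ~ c ++ side r' (~~ d) ++ c'.
    exists [:: (e, d)]; split=> /=; rewrite ?eE; first exact: edge_cube_edge.
      by rewrite /origin /= face_edge_cube bE.
    by rewrite /terminus /= face_edge_cube.
  have ww' : w ~ a ++ r.1 ++ c ++ side r' (~~ d) ++ c'.
    apply: word_connected_trans ww _; do 2![apply: word_connected_cat; first exact: word_connected_refl].
    exact: cc.
  apply: rst_trans (ih _ ww' hp); rewrite -bE.
  have par : @parallel (squier_component P w) (edge_cube a r (c ++ side r' false ++ c'))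
      (edge_cube a r (c ++ side r' true ++ c')).
    exists (edge_cube a r c ++ inr r' :: vertex_cube c'), 1.
    have E : edge_cube a r c ++ inr r' :: vertex_cube c' =
        vertex_cube a ++ inr r :: edge_cube c r' c' by rewrite /edge_cube -catA.
    split=> //; last first.
    - by rewrite E /= squier_faceS face_edge_cube.
    - by rewrite E /= squier_faceS face_edge_cube.
    rewrite E; split; last by rewrite /= /edge_cube !squier_dim_cat /= squier_dim_cat /= !squier_dim_vertex.
    apply/component_squierP; split.
      apply/squier_cubes_cat; split; first exact: squier_cubes_vertex.
      by apply/squier_cubes_cons; split=> //; have [] := edge_cube_edge c c' r'P.
    rewrite base_word_cat /= base_word_cat /= !base_word_vertex.
    rewrite -bE in ww; apply: word_connected_trans ww _.
    do 3![apply: word_connected_cat; first exact: word_connected_refl].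
    apply: word_connected_cat; last exact: word_connected_refl.
    case: (d); last exact: word_connected_refl.
    exact/word_connected_sym/word_connected_relation.
  by case: (d) => /=; [apply: rst_sym|]; apply: rst_step.
case=> /= /squier_edgeP[c [r' [c' [eE r'P]]]] + hp bb; rewrite /origin /=.
rewrite eE face_edge_cube => /vertex_cube_inj aE.
rewrite /terminus /= eE face_edge_cube in hp.
have cc : a ~ c ++ side r' (~~ d) ++ c'.
  exists [:: (e, d)]; split=> /=; rewrite ?eE; first exact: edge_cube_edge.
    by rewrite /origin /= face_edge_cube aE.
  by rewrite /terminus /= face_edge_cube.
have ww' : w ~ (c ++ side r' (~~ d) ++ c') ++ r.1 ++ b.
  apply: word_connected_trans ww _; apply: word_connected_cat => //.
  exact: word_connected_refl.
apply: rst_trans (ih _ ww' hp bb); rewrite -aE.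
have par : @parallel (squier_component P w) (edge_cube (c ++ side r' false ++ c') r b)
    (edge_cube (c ++ side r' true ++ c') r b).
  exists (vertex_cube c ++ inr r' :: edge_cube c' r b), 0.
  split=> //; last first.
  - by rewrite /= squier_face0 /edge_cube !vertex_cube_cat -!catA.
  - by rewrite /= squier_face0 /edge_cube !vertex_cube_cat -!catA.
  split; last by rewrite /= /edge_cube !squier_dim_cat /= squier_dim_cat /= !squier_dim_vertex.
  apply/component_squierP; split.
    apply/squier_cubes_cat; split; first exact: squier_cubes_vertex.
    by apply/squier_cubes_cons; split=> //; have [] := edge_cube_edge c' b rP.
  rewrite base_word_cat /= base_word_cat /= !base_word_vertex.
  rewrite -aE -!catA in ww; apply: word_connected_trans ww _.
  apply: word_connected_cat; first exact: word_connected_refl.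
  apply: word_connected_cat; last exact: word_connected_refl.
  case: (d); last exact: word_connected_refl.
  exact/word_connected_sym/word_connected_relation.
by case: (d) => /=; [apply: rst_sym|]; apply: rst_step.
Qed.

End LeftHyperplanes.

(** * Vertices and edges of the graph of left hyperplanes *)

Section LeftGraph.
Variables (Sigma : choiceType) (P : presentation Sigma) (w : seq Sigma).
Local Notation word := (seq Sigma).
Local Notation S := (squier P).
Local Notation T := (trivial_diagram_group P).
Local Notation "a ~ b" := (word_connected P a b) (at level 70).
Local Notation same_hyperplane :=
  (clos_refl_sym_trans (cube (squier_component P w)) (@parallel (squier_component P w))).
Implicit Types (a b c u v : word) (r : word * word) (l : Sigma).
Implicit Types (x y : squier_cube Sigma) (J : left_hyperplanes P w).

Definition relation_of J : word * word := (representative J).1.2.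

Lemma representative_spec J :
  [/\ relations P (relation_of J), w ~ prefix_of J ++ (relation_of J).1 ++ suffix_of J,
    \val J = @hyperplane (squier_component P w)
      (edge_cube (prefix_of J) (relation_of J) (suffix_of J)),
    T (prefix_of J) & ~ T (prefix_of J ++ (relation_of J).1)].
Proof.
have := representativeP J; rewrite /prefix_of /suffix_of /relation_of.
case: (representative J) => -[a [u v]] b /= [/component_edge_cube[rP ww] E Da nD].
by split.
Qed.

Lemma side_word_connected J e : w ~ prefix_of J ++ side_word J e ++ suffix_of J.
Proof.
have [rP ww _ _ _] := representative_spec J.
apply: word_connected_trans ww _; apply: word_connected_cat.
  exact: word_connected_refl.
apply: word_connected_cat; last exact: word_connected_refl.
by case: e; [exact: word_connected_relation|exact: word_connected_refl].
Qed.

Lemma side_cubes_spec J e : exists p l s,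
  [/\ side_word J e = p ++ l :: s, T (prefix_of J ++ p), ~ T (rcons (prefix_of J ++ p) l) &
    side_cubes J e = joined_cubes P (prefix_of J ++ p) [:: l] (s ++ suffix_of J)].
Proof.
rewrite /side_cubes /letter_splitting; case: cid => -[[p l] s] /= [uE h1 h2].
by exists p, l, s; split=> //; rewrite rcons_cat.
Qed.

Lemma left_vertex_spec (A : left_vertices P w) : exists a l b,
  [/\ \val A = joined_cubes P a [:: l] b, T a, ~ T (rcons a l) & w ~ a ++ l :: b].
Proof.
have [J [e ->]] := set_valP A; have [p [l [s [uE h1 h2 ->]]]] := side_cubes_spec J e.
exists (prefix_of J ++ p), l, (s ++ suffix_of J); split=> //.
by have := side_word_connected J e; rewrite uE -!catA.
Qed.

(** Triviality depends only on the component, so the conditions on [a] pass to the base word of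
    [x1], in the form that [cube_splitting_uniq] expects. *)
Lemma joined_letter_cubesP a l b x : T a -> ~ T (rcons a l) ->
  joined_cubes P a [:: l] b x -> exists x1 x2, [/\ x = x1 ++ inl l :: x2,
    a ~ base_word x1, b ~ base_word x2, T (base_word x1) &
    ~ T (base_word (rcons x1 (inl l)))].
Proof.
move=> Da nDal /joined_cubesP[x1 [x2 [-> /component_squierP[_ ax] /component_squierP[_ bx]]]].
exists x1, x2; split=> //; first exact: trivial_diagram_group_connected ax Da.
rewrite -cats1 base_word_cat /= cats1 => D; apply: nDal.
apply: trivial_diagram_group_connected D; rewrite -!cats1.
by apply: word_connected_cat; [exact: word_connected_sym|exact: word_connected_refl].
Qed.

(* If no derivation step crosses the last letter, every loop at [rcons a l] is the
   right translate by l of a loop at a. *)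
Lemma crossing_edge_exists a l : T a -> ~ T (rcons a l) -> exists a' c r d,
  [/\ a' ~ a, relations P r, rcons a' l = c ++ side r d & T c].
Proof.
move=> Da nDal; apply: contrapT => no; apply: nDal.
apply/trivial_diagram_groupP => p hp.
suff h a1 q z : a ~ a1 -> edge_path S (vertex_cube (rcons a1 l)) q z -> exists q' a2,
    [/\ z = vertex_cube (rcons a2 l),
      q = map_path (X := S) (Y := S) (extend_cube [::] [:: l]) q' &
      edge_path S (vertex_cube a1) q' (vertex_cube a2)].
  have [q' [a2 [/vertex_cube_inj aE qE hq']]] := h _ _ _ (word_connected_refl P a) hp.
  have {aE} aE : a = a2.
    by have := congr1 rev aE; rewrite !rev_rcons => -[/(can_inj revK)].
  rewrite -aE in hq'; have /trivial_diagram_groupP/(_ _ hq') := Da.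
  move=> /(homotopic_map (@extend_cube_map _ P [::] [:: l])); rewrite -qE.
  have -> // : extend_cube [::] [:: l] (vertex_cube a) = vertex_cube (rcons a l).
  by rewrite /extend_cube -cats1 vertex_cube_cat.
elim: q a1 => [|[e d] q ih] a1 aa1 /=.
  by move=> <-; exists [::], a1.
case=> /squier_edgeP[c [r [b [eE rP]]]]; rewrite eE /origin /terminus /=.
rewrite !face_edge_cube => /vertex_cube_inj.
have rN := @relations_neq1 _ P r.1 r.2; have {}rN : side r d <> [::].
  by case: rN; [case: (r) rP|case: d].
(* An edge with empty right context reaches the last letter: it is a crossing edge, whose prefix [c]
   is a prefix of [a1] and so has trivial diagram group. Any other edge leaves [l] untouched and is
   a translate. *)
case: (lastP b) eE => [|b' l'] eE.
  rewrite !cats0 => aE; case: no; exists a1, c, r, d; split=> //.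
  - exact: word_connected_sym.
  - case: (lastP (side r d)) rN aE => // s l' _; rewrite -rcons_cat => /rcons_inj[aE _].
    by apply: (@trivial_diagram_group_cat _ _ c s); rewrite aE;
      exact: trivial_diagram_group_connected aa1 Da.
rewrite -!rcons_cat => /rcons_inj[aE ll] hq; rewrite ll in eE hq.
have eE' : e = extend_cube [::] [:: l] (edge_cube c r b').
  by rewrite eE /extend_cube /edge_cube /= -cats1 vertex_cube_cat -!catA.
have e1 : edge_path S (vertex_cube a1) [:: (edge_cube c r b', d)]
    (vertex_cube (c ++ side r (~~ d) ++ b')).
  split=> /=; first exact: edge_cube_edge.
  - by rewrite /origin /= face_edge_cube aE.
  - by rewrite /terminus /= face_edge_cube.
have [|q' [a2 [zE qE hq']]] := ih _ _ hq.
  by apply: word_connected_trans aa1 _; exists [:: (edge_cube c r b', d)].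
exists ((edge_cube c r b', d) :: q'), a2; split=> //; first by rewrite qE ll -eE eE'.
exact: (edge_path_cat e1 hq').
Qed.

(** The representative chosen for the hyperplane need not be [(a, r, b)], but its contexts lie in
    the same components. *)
Lemma left_hyperplane_of a r b : relations P r -> w ~ a ++ r.1 ++ b -> T a ->
  ~ T (a ++ r.1) -> exists J, [/\ relation_of J = r, prefix_of J ~ a & suffix_of J ~ b].
Proof.
move=> rP ww Da nD.
have JP : @hyperplane (squier_component P w) (edge_cube a r b) \in left_hyperplanes P w.
  rewrite inE; exists (a, r, b); case: r rP ww nD => u v rP ww nD.
  by split=> //; exact: edge_cube_component.
exists (SigSub JP); have [_ _ JE _ _] := representative_spec (SigSub JP).
have : \val (SigSub JP) (edge_cube a r b) by exact: rst_refl.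
rewrite JE => /same_hyperplane_contexts [a' [b' [/edge_cube_inj[aE rE bE] h1 h2]]].
by split; [rewrite -rE|rewrite [X in _ ~ X]aE|rewrite [X in _ ~ X]bE].
Qed.

(** Some rewriting consumes the letter [l]; its hyperplane is left, and [l] is the last letter of
    the side [d] of its relation. *)
Lemma left_vertex_exists a l b : T a -> ~ T (rcons a l) -> w ~ a ++ l :: b ->
  joined_cubes P a [:: l] b \in left_vertices P w.
Proof.
move=> Da nDal ww; have [a' [c [r [d [aa rP aE Dc]]]]] := crossing_edge_exists Da nDal.
have al : rcons a' l ~ rcons a l.
  by rewrite -!cats1; apply: word_connected_cat => //; exact: word_connected_refl.
have r1d : r.1 ~ side r d.
  by case: (d); [exact: word_connected_relation|exact: word_connected_refl].
have cr : c ++ r.1 ~ rcons a' l.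
  by rewrite aE; apply: word_connected_cat => //; exact: word_connected_refl.
have [||J [rE pc sb]] := @left_hyperplane_of c r b rP _ Dc.
- rewrite catA; apply: word_connected_trans ww _; apply: word_connected_sym.
  rewrite -cat_rcons; apply: word_connected_cat; last exact: word_connected_refl.
  exact: word_connected_trans cr al.
- by move=> /(trivial_diagram_group_connected (word_connected_trans cr al)).
rewrite inE; exists J, d; have [p [l' [s [uE h1 h2 ->]]]] := side_cubes_spec J d.
have {}uE : side r d = p ++ l' :: s by rewrite -uE -rE.
have [p0 sE] : exists p0, side r d = rcons p0 l.
  case: (lastP (side r d)) uE aE => [|p0 l0] uE; first by case: p uE h1 h2.
  by rewrite -rcons_cat => /rcons_inj[_ ->]; exists p0.
have aE' : a' = c ++ p0 by move: aE; rewrite sE -rcons_cat => /rcons_inj[].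
have pa : prefix_of J ++ p0 ~ a.
  apply: word_connected_trans aa; rewrite aE'.
  by apply: word_connected_cat => //; exact: word_connected_refl.
(* The word [prefix_of J ++ side r d] splits at its last letter [l], and also at the letter fixed by
   [side_cubes]; uniqueness identifies the two. *)
have [|||E1 E2 E3] := @word_splitting_uniq _ P (prefix_of J ++ p0) l [::] (prefix_of J ++ p) l' s
  _ _ _ h1 h2.
- by rewrite -!catA -uE sE cats1.
- exact: trivial_diagram_group_connected (word_connected_sym pa) Da.
- move=> D; apply: nDal; apply: trivial_diagram_group_connected D; rewrite -!cats1.
  by apply: word_connected_cat => //; exact: word_connected_refl.
rewrite -E1 -E2 -E3 /=; apply: joined_cubes_connected; exact: word_connected_sym.
Qed.

End LeftGraph.

(** * The decomposition of the Squier complex and its gluing maps *)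

Section LeftDecomposition.
Variables (Sigma : choiceType) (P : presentation Sigma) (w : seq Sigma).
Local Notation word := (seq Sigma).
Local Notation S := (squier P).
Local Notation X := (squier_component P w).
Local Notation G := (left_graph P w).
Local Notation T := (trivial_diagram_group P).
Local Notation "a ~ b" := (word_connected P a b) (at level 70).
Implicit Types (J : left_hyperplanes P w).

Definition left_middle J (c : cube (edge_space (s := G) J)) : cube X :=
  c.1 ++ inr (relation_of J) :: c.2.

(** The relation symbols of [c.1] precede the inserted one, which therefore has coordinate number
    [dim c.1]. *)
Definition left_position J (c : cube (edge_space (s := G) J)) : nat := dim c.1.

(** The product x (p l s) y is regrouped as (x p) l (s y). *)
Lemma glue_side_cubes J e (c : cube (edge_space (s := G) J)) :
  cubes (edge_space (s := G) J) c -> side_cubes J e (@glue G J e c).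
Proof.
move: c => [x y] [/= /component_squierP[xP ax] /component_squierP[yP bx]].
have [p [l [s [uE _ _ ->]]]] := side_cubes_spec J e.
apply/joined_cubesP; exists (x ++ vertex_cube p), (vertex_cube s ++ y); split.
- by rewrite /insert_word uE vertex_cube_cat /= -!catA.
- apply/component_squierP; split.
    by apply/squier_cubes_cat; split=> //; exact: squier_cubes_vertex.
  rewrite base_word_cat base_word_vertex; apply: word_connected_cat => //.
  exact: word_connected_refl.
- apply/component_squierP; split.
    by apply/squier_cubes_cat; split=> //; exact: squier_cubes_vertex.
  rewrite base_word_cat base_word_vertex; apply: word_connected_cat => //.
  exact: word_connected_refl.
Qed.

Lemma glue_combinatorial J e : combinatorial_map (@glue G J e).
Proof.
move=> c cE; have [_ h1 h2] := @insert_word_map _ P _ (side_word J e) _ c cE.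
split=> //; exact: glue_side_cubes.
Qed.

Lemma left_inclusion_map (A : graph_vertex G) :
  combinatorial_map (@left_inclusion Sigma P w A).
Proof.
move=> c cA; split=> //; have [a [l [b [E _ _ ww]]]] := left_vertex_spec A.
by move: cA; rewrite /= E; exact: joined_cubes_component.
Qed.

Lemma left_middle_component J c :
  cubes (edge_space (s := G) J) c -> cubes X (left_middle c).
Proof.
move: c => [x y] [/= /component_squierP[xP ax] /component_squierP[yP bx]].
have [rP ww _ _ _] := representative_spec J.
apply/component_squierP; split.
  by apply/squier_cubes_cat; split=> //; apply/squier_cubes_cons.
rewrite base_word_cat; apply: word_connected_trans ww _.
apply: word_connected_cat => //; apply: word_connected_cat => //.
exact: word_connected_refl.
Qed.

Lemma left_middle_spec J c : cubes (edge_space (s := G) J) c ->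
  [/\ prefix_of J ~ base_word c.1, suffix_of J ~ base_word c.2,
    T (base_word c.1) & ~ T (base_word (rcons c.1 (inr (relation_of J))))].
Proof.
move: c => [x y] [/= /component_squierP[xP ax] /component_squierP[yP bx]].
have [rP ww _ Da nD] := representative_spec J.
split=> //; first exact: trivial_diagram_group_connected ax Da.
rewrite -cats1 base_word_cat /= cats0 => D; apply: nD.
apply: trivial_diagram_group_connected D; apply: word_connected_cat.
  exact: word_connected_sym.
exact: word_connected_refl.
Qed.

Hypothesis D_neq1 : ~ T w.

Lemma left_cube_cases (c : cube X) : cubes X c ->
  (exists A (c' : cubes (vertex_space (s := G) A)), left_inclusion (\val c') = c) \/
  (exists J (c' : cubes (edge_space (s := G) J)), left_middle (\val c') = c).
Proof.
move=> /component_squierP[cP wc].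
(* The base word of [c] is connected to [w], so its diagram group is nontrivial and the scan
   stops. *)
have [] := @cube_splitting _ P [::] c (@trivial_diagram_group_nil _ P).
  by move=> /(trivial_diagram_group_connected (word_connected_sym wc)).
move=> x [[l|r] [y [cE Dx nDxl]]]; rewrite cat0s in Dx nDxl; move: cP wc;
  rewrite cE base_word_cat => /squier_cubes_cat[xP].
  move=> /(@squier_cubes_cat _ P [:: inl l] y)[_ yP] wc; left.
  have nDxl' : ~ T (rcons (base_word x) l).
    by move: nDxl; rewrite -!cats1 base_word_cat.
  have AP := left_vertex_exists Dx nDxl' wc.
  have cA : c \in cubes (vertex_space (s := G) (SigSub AP)).
    rewrite inE cE; apply/joined_cubesP; exists x, y.
    by split=> //; apply/component_squierP; split=> //; exact: word_connected_refl.
  by exists (SigSub AP), (SigSub cA); rewrite -cE.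
move=> /squier_cubes_cons[rP yP] wc; right.
have nDxr : ~ T (base_word x ++ r.1) by move: nDxl; rewrite -cats1 base_word_cat /= cats0.
have [J [rE pJ sJ]] := left_hyperplane_of rP wc Dx nDxr.
have cJ : (x, y) \in cubes (edge_space (s := G) J).
  by rewrite inE; split; apply/component_squierP.
by exists J, (SigSub cJ); rewrite /left_middle /= rE.
Qed.

Lemma left_inclusion_inj A A' (c : cubes (vertex_space (s := G) A))
    (c' : cubes (vertex_space (s := G) A')) :
  left_inclusion (\val c) = left_inclusion (\val c') ->
  existT (fun A => set_type (cubes (vertex_space (s := G) A))) A c = existT _ A' c'.
Proof.
rewrite /left_inclusion => cc.
have [a [l [b [AE Da nDal ww]]]] := left_vertex_spec A.
have [a' [l' [b' [AE' Da' nDal' ww']]]] := left_vertex_spec A'.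
have cA B : \val A = B -> B (\val c) by move=> <-; exact: set_valP.
have := cA _ AE => /(joined_letter_cubesP Da nDal).
move=> [x [y [cE ax bx Dx nDx]]].
have cA' B : \val A' = B -> B (\val c') by move=> <-; exact: set_valP.
have := cA' _ AE' => /(joined_letter_cubesP Da' nDal').
move=> [x' [y' [cE' ax' bx' Dx' nDx']]].
have [xx [ll] yy] := cube_splitting_uniq (etrans (esym cE) (etrans cc cE')) Dx nDx Dx' nDx'.
(* The common splitting determines the letter and the components on both sides, hence the
   vertex-space as a set of cubes. *)
have AA : A = A'.
  apply/val_inj; rewrite AE AE' ll; apply: joined_cubes_connected.
    by apply: word_connected_trans ax _; rewrite xx; exact: word_connected_sym.
  by apply: word_connected_trans bx _; rewrite yy; exact: word_connected_sym.
by case: _ / AA c' cc {cE' cA'} => c' cc; congr existT; exact: val_inj.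
Qed.

Lemma left_middle_inj J J' (c : cubes (edge_space (s := G) J))
    (c' : cubes (edge_space (s := G) J')) :
  left_middle (\val c) = left_middle (\val c') ->
  existT (fun J => set_type (cubes (edge_space (s := G) J))) J c = existT _ J' c'.
Proof.
rewrite /left_middle => cc.
have [aJ bJ DJ nDJ] := left_middle_spec (set_valP c).
have [aJ' bJ' DJ' nDJ'] := left_middle_spec (set_valP c').
have [xx [rr] yy] := cube_splitting_uniq cc DJ nDJ DJ' nDJ'.
have [rP ww JE _ _] := representative_spec J.
have [rP' ww' JE' _ _] := representative_spec J'.
have JJ : J = J'.
  apply/val_inj; rewrite JE JE'; rewrite predeqE => f /=.
  have h : clos_refl_sym_trans (cube X) (@parallel X)
     (edge_cube (prefix_of J) (relation_of J) (suffix_of J))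
     (edge_cube (prefix_of J') (relation_of J') (suffix_of J')).
    rewrite -rr; apply: same_hyperplane_connected => //.
      by apply: word_connected_trans aJ _; rewrite xx; exact: word_connected_sym.
    by apply: word_connected_trans bJ _; rewrite yy; exact: word_connected_sym.
  by split; [apply: rst_trans (rst_sym _ _ _ _ h)|apply: rst_trans h].
case: _ / JJ c' xx yy {cc aJ' bJ' DJ' nDJ'} => c' xx yy; congr existT; apply: val_inj.
by move: xx yy; case: (\val c) => ? ?; case: (\val c') => ? ? /= -> ->.
Qed.

Lemma left_inclusion_middle A J (c : cubes (vertex_space (s := G) A))
    (c' : cubes (edge_space (s := G) J)) :
  left_inclusion (\val c) <> left_middle (\val c').
Proof.
rewrite /left_inclusion /left_middle => cc.
have [a [l [b [AE Da nDal ww]]]] := left_vertex_spec A.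
have [aJ bJ DJ nDJ] := left_middle_spec (set_valP c').
have cA B : \val A = B -> B (\val c) by move=> <-; exact: set_valP.
have := cA _ AE => /(joined_letter_cubesP Da nDal).
move=> [x [y [cE ax bx Dx nDx]]].
by have [] := cube_splitting_uniq (etrans (esym cE) cc) Dx nDx DJ nDJ.
Qed.

Lemma left_graph_decomposition (R : realType) :
  decomposition R (X := X) (@left_inclusion Sigma P w).
Proof.
apply: (@graph_decomposition R G X (@left_inclusion Sigma P w) left_middle left_position).
- exact: left_inclusion_map.
- exact: glue_combinatorial.
- exact: left_middle_component.
- by move=> J [x y] _; rewrite /left_middle /= squier_dim_cat /= addnS.
- by move=> J [x y] _; exact: leq_addr.
- move=> J [x y] i e _; rewrite /left_position /= => ix; case: ltnP => ixx /=.
    have := squier_dim_face e ixx; rewrite /unbump ixx; lia.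
  by rewrite /unbump ltnNge ixx subn0.
- by move=> J [x y] e _; rewrite /left_middle /left_position /= squier_face_cat ltnn subnn.
- move=> J [x y] i e _ ix; rewrite /left_middle /left_position /= squier_face_cat /bump.
  case: (leqP (squier_dim x) i) => xi /=; last by rewrite xi.
  by rewrite add1n ltnNge (leqW xi) /= subSn.
- exact: left_cube_cases.
- exact: left_inclusion_inj.
- exact: left_middle_inj.
- exact: left_inclusion_middle.
Qed.

(** The first factor has trivial fundamental group, so both loops move into the slice over [x];
    there gluing is a left translation, which reflects homotopy. *)
Lemma glue_pi1_injective J e : pi1_injective (@glue G J e).
Proof.
move=> z vz p q hp hq h.
case: z vz hp hq h => x y [[/= xJ yJ] xy0] hp hq h.
have vx : @vertex (squier_component P (prefix_of J)) x.
  by split=> //; move: xy0 => /=; lia.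
have vy : @vertex (squier_component P (suffix_of J)) y.
  by split=> //; move: xy0 => /=; lia.
have [_ _ _ Da _] := representative_spec J.
have [a xE] := squier_dim0 vx.2.
have [s hs] : connected_to S (vertex_cube (prefix_of J)) x.
  by have /component_squierP[_] := xJ; rewrite xE base_word_vertex.
have aa : connected_to S (vertex_cube (prefix_of J)) (vertex_cube (prefix_of J)) by exists [::].
have Dx : trivial_pi1 (squier_component P (prefix_of J)) x.
  by apply: trivial_pi1_move Da; exact: edge_path_component aa hs.
have hp' := homotopic_right_path vx vy Dx hp.
have hq' := homotopic_right_path vx vy Dx hq.
pose Z := product_complex (squier_component P (prefix_of J)) (squier_component P (suffix_of J)).
suff h2 : homotopic Z (x, y) (x, y)
    (map_path (X := squier_component P (suffix_of J)) (Y := Z) (fun d => (x, d)) (right_path p))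
    (map_path (X := squier_component P (suffix_of J)) (Y := Z) (fun d => (x, d)) (right_path q)).
  exact: (homotopic_trans hp' (homotopic_trans h2 (homotopic_sym hq'))).
have [_ /= hp2 _] := product_path_split vx vy hp.
have [_ /= hq2 _] := product_path_split vx vy hq.
have gm := @glue_combinatorial J e.
have {}h := homotopic_trans (homotopic_sym (homotopic_map gm hp'))
  (homotopic_trans h (homotopic_map gm hq')).
apply: (homotopic_map (product_slice_right vx)).
have by_ : connected_to S (vertex_cube (suffix_of J)) y.
  have [b yE] := squier_dim0 vy.2; move: yJ; rewrite yE => /component_squierP[_].
  by rewrite base_word_vertex.
apply: homotopic_component => //.
(* The vertex [x] is the word [a], so on the slice gluing multiplies on the left by
   [a ++ side_word J e]. *)
apply: (@homotopic_extend _ P (a ++ side_word J e) [::]).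
- exact: edge_path_subcomplex hp2.
- exact: edge_path_subcomplex hq2.
have := homotopic_subcomplex h.
have E d : @glue G J e (x, d) = extend_cube (a ++ side_word J e) [::] d.
  by rewrite /= /insert_word /= xE /extend_cube cats0 vertex_cube_cat -catA.
have mE (r : seq (oriented_edge (squier_component P (suffix_of J)))) :
    map_path (X := Z) (@glue G J e)
      (map_path (X := squier_component P (suffix_of J)) (Y := Z) (fun d => (x, d)) r) =
    map_path (X := S) (Y := S) (extend_cube (a ++ side_word J e) [::]) r.
  by elim: r => //= -[d b] r ->; rewrite -E.
by rewrite -!mE -!E.
Qed.

End LeftDecomposition.

Theorem theorem5p8 (R : realType) (Sigma : choiceType) (P : presentation Sigma)
    (w : seq Sigma) (w_neq1 : w <> [::]) (D_neq1 : ~ trivial_diagram_group P w) :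
  is_graph_of_spaces (left_graph P w) /\
  decomposition R (X := squier_component P w) (@left_inclusion Sigma P w).
Proof.
split; last exact: left_graph_decomposition.
by move=> J e; split; [exact: glue_combinatorial|exact: glue_pi1_injective].
Qed.
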